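(* Let $d\geq 2$ be an integer and let $2<q<\frac{2d}{d-2}$ (with the convention $\frac{2d}{d-2}=\infty$ if $d=2$). For $\epsilon>0$ let $$u_\epsilon(\omega) := 1 + \epsilon\, \omega_{d+1} + \epsilon^2\, \frac{d(q-1)}{2(d+2)}\left(\omega_{d+1}^2-\frac{1}{d+1}\right), \qquad \omega=(\omega_1,\ldots,\omega_{d+1})\in\mathbb{S}^d.$$ Then $$ \lim_{\epsilon\to 0^+} \frac{\| u_\epsilon\|^2 \left( \|u_\epsilon\|^2 - Y\|u_\epsilon\|_q^2\right)}{\| u_\epsilon -\overline{u_\epsilon}\|^4} = \frac{(d+1)(q-2)(2d-q(d-2))}{2(d+2)(d+3)(q-1)} \,. $$ In particular, the following hold. (i) In the statement ''for every sequence $(u_n)\subset H^1(\mathbb{S}^d)$ of nonconstant functions with $\|u_n\|^2=Y$ and $\|u_n\|_q\to 1$ one has $\liminf_{n\to\infty} \frac{\| u_n\|^2 ( \|u_n\|^2 - Y\|u_n\|_q^2)}{\| u_n -\overline{u_n}\|^4} \geq \frac{(d+1)(q-2)(2d-q(d-2))}{2(d+2)(d+3)(q-1)}$'', the constant on the right side cannot be replaced by a larger one. (ii) The power four is best possible: for any $\alpha<4$ there is no constant $c>0$ such that $\|u\|^2 - Y\|u\|_q^2 \geq c\, \|u\|^{2-\alpha}\,\|u-\overline u\|^{\alpha}$ for all nonconstant $u\in H^1(\mathbb{S}^d)$.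
   Context: All functions are real-valued. $\mathbb{S}^d\subset\mathbb{R}^{d+1}$ is the unit sphere with its round metric, $d\omega$ its (unnormalized) surface measure, $|\mathbb{S}^d|=\int_{\mathbb{S}^d}d\omega$. Notation: $\| u \|^2 := \int_{\mathbb{S}^d} \left( |\nabla u|^2 + \frac{d}{q-2} u^2\right)d\omega$, $\|u\|_q := \left(\int_{\mathbb{S}^d}|u|^q\,d\omega\right)^{1/q}$, $\overline u := |\mathbb{S}^d|^{-1} \int_{\mathbb{S}^d} u\,d\omega$, and $Y := \frac{d}{q-2}\,|\mathbb{S}^d|^{1-2/q}$. *)

(* Defs.v *)
From HB Require Import structures.
From mathcomp Require Import all_boot all_order all_algebra.
From mathcomp Require Import all_classical all_reals all_analysis.
From mathcomp Require Import measurable_realfun.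

Set Implicit Arguments.
Unset Strict Implicit.
Unset Printing Implicit Defensive.
Import Order.TTheory GRing.Theory Num.Theory.
Import numFieldNormedType.Exports.

Local Open Scope classical_set_scope.
Local Open Scope ring_scope.

Definition rV_display : measure_display.
Proof. exact: default_measure_display. Qed.

Definition mpushforward d d' (T1 : measurableType d) (T2 : measurableType d')
    (R : realType) (m : {measure set T1 -> \bar R}) (f : T1 -> T2)
    (mf : measurable_fun setT f) : {measure set T2 -> \bar R} :=
  measure_function_pushforward__canonical__measure_function_Measure m mf.

(** The Borel sigma-algebra of R^n, generated by the n coordinates. *)
Section rV_measurable.
Context {R : realType} {n : nat}.

Definition rV_coord (i : 'I_n) (x : 'rV[R]_n) : R := x 0 i.

Let rV_set0 : g_sigma_preimage rV_coord set0.
Proof. exact: sigma_algebra0. Qed.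

Let rV_setC A : g_sigma_preimage rV_coord A -> g_sigma_preimage rV_coord (~` A).
Proof. exact: sigma_algebraC. Qed.

Let rV_bigcup (F : _^nat) : (forall i, g_sigma_preimage rV_coord (F i)) ->
  g_sigma_preimage rV_coord (\bigcup_i (F i)).
Proof. exact: sigma_algebra_bigcup. Qed.

HB.instance Definition _ := @isMeasurable.Build rV_display 'rV[R]_n
  (g_sigma_preimage rV_coord) rV_set0 rV_setC rV_bigcup.

Lemma measurable_rV_coord (i : 'I_n) : measurable_fun setT (rV_coord i).
Proof.
move=> _ Y mY; rewrite setTI; apply: sub_sigma_algebra => /=.
rewrite -bigcup_seq/=; exists i => /=; first by rewrite mem_index_enum.
by exists Y => //; rewrite setTI.
Qed.

Lemma measurable_fun_rVP d (T : measurableType d) (f : T -> 'rV[R]_n) :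
  (forall i, measurable_fun setT (fun x => f x 0 i)) -> measurable_fun setT f.
Proof.
move=> mf _ Y mY; rewrite setTI.
have : g_sigma_preimage (fun i => rV_coord i \o f) (f @^-1` Y).
  by rewrite g_sigma_preimage_comp; exists Y; rewrite // setTI.
apply: smallest_sub; first exact: sigma_algebra_measurable.
rewrite -bigcup_seq; apply: bigcup_sub => i _ _ [B mB <-].
exact: mf.
Qed.

End rV_measurable.

Section euclidean.
Context {R : realType} {n : nat}.

Definition dotp (x y : 'rV[R]_n) : R := \sum_(i < n) x 0 i * y 0 i.

(** The Euclidean norm (the library's norm `|x| on row vectors is the sup
    norm). *)
Definition enorm (x : 'rV[R]_n) : R := Num.sqrt (dotp x x).

Definition normalize (x : 'rV[R]_n) : 'rV[R]_n := (enorm x)^-1 *: x.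

Lemma enorm_normalize (x : 'rV[R]_n) : 0 < enorm x -> enorm (normalize x) = 1.
Proof.
move=> x0; rewrite {1}/enorm.
have -> : dotp (normalize x) (normalize x) = (enorm x)^-1 ^+ 2 * dotp x x.
  rewrite /dotp mulr_sumr; apply: eq_bigr => i _.
  by rewrite !mxE expr2 mulrACA.
rewrite sqrtrM ?sqr_ge0// sqrtr_sqr ger0_norm ?invr_ge0 ?sqrtr_ge0//.
by rewrite mulVf ?gt_eqF.
Qed.

Definition punctured_ball : set 'rV[R]_n := [set x | 0 < enorm x <= 1].

Lemma measurable_enorm : measurable_fun setT enorm.
Proof.
apply: (measurableT_comp (f := @Num.sqrt R)).
  by apply: continuous_measurable_fun; exact: sqrt_continuous.
by apply: measurable_sum => i; apply: measurable_funM; exact: measurable_rV_coord.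
Qed.

Lemma measurable_normalize : measurable_fun setT normalize.
Proof.
apply: measurable_fun_rVP => i.
rewrite (_ : (fun _ => _) = (fun x => enorm x `^ (-1) * rV_coord i x)).
  apply: measurable_funM; last exact: measurable_rV_coord.
  exact: (measurableT_comp (measurable_powR _) measurable_enorm).
by apply/funext => x; rewrite /normalize mxE powR_inv1// sqrtr_ge0.
Qed.

Lemma measurable_punctured_ball : measurable punctured_ball.
Proof.
rewrite (_ : punctured_ball = enorm @^-1` `]0, 1]).
  by rewrite -[X in measurable X]setTI; exact: measurable_enorm.
by apply/seteqP; split=> x; rewrite /punctured_ball /= in_itv.
Qed.

End euclidean.

Section sphere.
Context {R : realType}.

Definition rV_cons (n : nat) (p : R * 'rV[R]_n) : 'rV[R]_n.+1 :=
  row_mx (const_mx p.1 : 'rV_1) p.2.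

Lemma measurable_rV_cons n : measurable_fun setT (@rV_cons n).
Proof.
apply: measurable_fun_rVP => i; rewrite /rV_cons.
case: (@split_ordP 1 n i) => j ->.
  rewrite (_ : (fun _ => _) = fst); first exact: measurable_fst.
  by apply/funext => x; apply: (etrans (row_mxEl _ _ _ _)); rewrite mxE.
rewrite (_ : (fun _ => _) = rV_coord j \o snd).
  exact: measurableT_comp (measurable_rV_coord j) measurable_snd.
by apply/funext => x; exact: row_mxEr.
Qed.

(** Lebesgue measure on R^n, as an iterated product of one-dimensional Lebesgue
    measures. The product [\x^] is used because it needs sigma-finiteness of its
    left factor only. *)
Fixpoint lebesgue_rV (n : nat) : {measure set 'rV[R]_n -> \bar R} :=
  match n with
  | 0 => dirac (0 : 'rV[R]_0)
  | m.+1 => mpushforward (@lebesgue_measure R \x^ lebesgue_rV m)%E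
                         (@measurable_rV_cons m)
  end.

Section surface_measure.
Variable d : nat.

Definition sphere : set 'rV[R]_d.+1 := [set x | enorm x = 1].

(** The surface measure of S^d: the surface measure of A is (d+1) times the
    Lebesgue measure of the cone {r w | 0 < r <= 1, w \in A}. It is a measure on
    the ambient space R^(d+1) that is carried by the sphere (lemma
    [sphere_measure_setC]). Accordingly, functions on S^d are represented below
    by functions on R^(d+1), of which only the values on S^d matter. *)
Definition sphere_measure : {measure set 'rV[R]_d.+1 -> \bar R} :=
  mscale (d.+1%:R)%:nng
    (mpushforward (mrestr (lebesgue_rV d.+1) measurable_punctured_ball)
                  (@measurable_normalize R d.+1)).

Lemma sphere_measureE (A : set 'rV[R]_d.+1) :
  sphere_measure A = (d.+1%:R%:E *
    lebesgue_rV d.+1 [set x | A (normalize x) /\ (0 < enorm x <= 1)%R])%E.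
Proof. by []. Qed.

Lemma sphere_measure_setC : sphere_measure (~` sphere) = 0%E.
Proof.
rewrite sphere_measureE (_ : [set x | _] = set0) ?measure0 ?mule0//.
apply/seteqP; split=> x //= -[nx /andP[x0 _]].
by apply: nx; exact: enorm_normalize.
Qed.

Definition sphere_area : R := fine (sphere_measure setT).

Definition partial (i : 'I_d.+1) (f : 'rV[R]_d.+1 -> R) : 'rV[R]_d.+1 -> R :=
  fun x => 'D_(delta_mx 0 i) f x.

Fixpoint Ck (k : nat) (f : 'rV[R]_d.+1 -> R) : Prop :=
  match k with
  | 0 => continuous f
  | j.+1 => forall i : 'I_d.+1,
      (forall x, derivable f x (delta_mx 0 i)) /\ Ck j (partial i f)
  end.

Definition smooth (f : 'rV[R]_d.+1 -> R) : Prop := forall k, Ck k f.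

(** The gradient on S^d of the restriction of f to S^d: the tangential part
    of the Euclidean gradient of f. *)
Definition sgrad (f : 'rV[R]_d.+1 -> R) (w : 'rV[R]_d.+1) : 'rV[R]_d.+1 :=
  let g := \row_i partial i f w in g - dotp g w *: w.

(** [H1 u G]: u belongs to H^1(S^d), the closure of C^oo(S^d) for the norm
    (|u|_2^2 + |grad u|_2^2)^(1/2), and G is its gradient, i.e. u and G are the
    L^2 limits of f_k and of grad f_k for some sequence of smooth f_k. The
    gradient G is determined by u up to a null set. Smooth functions on S^d are
    the restrictions of smooth functions on R^(d+1). *)
Definition H1 (u : 'rV[R]_d.+1 -> R) (G : 'rV[R]_d.+1 -> 'rV[R]_d.+1) : Prop :=
  [/\ u \in Lfun sphere_measure 2%:E,
      forall i, (fun w => G w 0 i) \in Lfun sphere_measure 2%:E &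
      exists f : nat -> 'rV[R]_d.+1 -> R,
        [/\ forall k, smooth (f k),
            (\int[sphere_measure]_w ((f k w - u w) ^+ 2)%:E)%E
              @[k --> \oo] --> 0%E &
            (\int[sphere_measure]_w (enorm (sgrad (f k) w - G w) ^+ 2)%:E)%E
              @[k --> \oo] --> 0%E]].

(** Elements of H^1(S^d) are only determined up to a null set. *)
Definition nonconstant (u : 'rV[R]_d.+1 -> R) : Prop :=
  ~ exists c : R, {ae sphere_measure, forall w, u w = c}.

Definition mean (u : 'rV[R]_d.+1 -> R) : R :=
  sphere_area^-1 * \int[sphere_measure]_w u w.

Section norms.
Variable q : R.

(** This is meant for G the gradient of u. *)
Definition H1norm (u : 'rV[R]_d.+1 -> R) (G : 'rV[R]_d.+1 -> 'rV[R]_d.+1) : R :=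
  Num.sqrt (\int[sphere_measure]_w
    (enorm (G w) ^+ 2 + d%:R / (q - 2) * u w ^+ 2)).

Definition qnorm (u : 'rV[R]_d.+1 -> R) : R :=
  fine ('N[sphere_measure]_q%:E[EFin \o u])%E.

Definition Yconst : R := d%:R / (q - 2) * sphere_area `^ (1 - 2 / q).

Definition deficit (u : 'rV[R]_d.+1 -> R) (G : 'rV[R]_d.+1 -> 'rV[R]_d.+1) : R :=
  H1norm u G ^+ 2 - Yconst * qnorm u ^+ 2.

(** Subtracting the mean does not change the gradient. *)
Definition dist_mean (u : 'rV[R]_d.+1 -> R)
    (G : 'rV[R]_d.+1 -> 'rV[R]_d.+1) : R :=
  H1norm (fun w => u w - mean u) G.

Definition stability_quotient (u : 'rV[R]_d.+1 -> R)
    (G : 'rV[R]_d.+1 -> 'rV[R]_d.+1) : R :=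
  H1norm u G ^+ 2 * deficit u G / dist_mean u G ^+ 4.

Definition u_eps (eps : R) (w : 'rV[R]_d.+1) : R :=
  1 + eps * w 0 ord_max
    + eps ^+ 2 * (d%:R * (q - 1) / (2 * (d%:R + 2)))
        * (w 0 ord_max ^+ 2 - 1 / (d%:R + 1)).

Definition stability_const : R :=
  ((d%:R + 1) * (q - 2) * (2 * d%:R - q * (d%:R - 2)))
    / (2 * (d%:R + 2) * (d%:R + 3) * (q - 1)).

Definition liminf_bound (C : R) : Prop :=
  forall (u : nat -> 'rV[R]_d.+1 -> R)
         (G : nat -> 'rV[R]_d.+1 -> 'rV[R]_d.+1),
    (forall n, H1 (u n) (G n) /\ nonconstant (u n)) ->
    (forall n, H1norm (u n) (G n) ^+ 2 = Yconst) ->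
    qnorm (u n) @[n --> \oo] --> (1 : R) ->
    (C%:E <= limn_einf (fun n => (stability_quotient (u n) (G n))%:E))%E.

End norms.
End surface_measure.
End sphere.

(* Main.v *)
Require Import Defs.
From HB Require Import structures.
From mathcomp Require Import all_boot all_order all_algebra.
From mathcomp Require Import all_classical all_reals all_analysis.
From mathcomp Require Import measurable_realfun ring lra.
Set Implicit Arguments.
Unset Strict Implicit.
Unset Printing Implicit Defensive.
Import Order.TTheory GRing.Theory Num.Theory.
Import numFieldNormedType.Exports.
Local Open Scope classical_set_scope.
Local Open Scope ring_scope.

(** The test functions u_eps are polynomials in the last coordinate t, so that all
    their norms are governed by the moments of t. The order of vanishing of the
    deficit at the constant function 1 is read off from an expansion in eps: in
    the direction t the term of order eps^2 cancels ([fluct2_excess2]), odd powers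
    of eps integrate to zero, and the quadratic correction in u_eps is the one
    that minimizes the term of order eps^4. As the squared distance to the mean is
    of order eps^2, the quotient has a limit, which is computed exactly.

    Moments. The surface measure is the image of Lebesgue measure on the unit
    ball. Lebesgue measure is invariant under shears, by Tonelli and translation
    invariance in one variable ([lebesgue_rV_shear]); a plane rotation is a
    product of three shears ([rot_shears]), and it commutes with the projection
    on the sphere, so the surface measure is invariant under plane rotations
    ([sphere_measure_rot]). Quarter and eighth turns together with the identity
    of the sphere give the moments of t up to order four ([sint_quartic]).

    Expansion. The squared H^1 norms of u_eps and u_eps - 1 are polynomials in
    eps ([H1norm_scaled_test], [dist_mean_scaled_test]). For the q-norm, the
    binomial expansion of (1 + s)^q with uniform remainder ([powR_taylor]) is
    integrated over the sphere, on which s = u_eps - 1 is uniformly small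
    ([excess_expansion]), and a second binomial expansion gives the power 2 / q
    of the integral ([cvg_binomial_rate]). This yields the limit of the deficit
    over eps^4 ([cvg_rate]), and [rate_limitE] identifies the constant.

    Consequences. The quotient is invariant under scaling, so the functions
    u_eps with eps = 1 / (k + 1), scaled to have squared norm Y, form an
    admissible sequence along which the quotient tends to the constant. For
    alpha < 4, the inequality with power alpha applied to u_eps bounds c by the
    quotient times a positive power of the ratio of the distance to the mean
    over the norm, which tends to 0 ([quotient_powR]). *)

(** * Lebesgue measure and shears *)

Section lebesgue_rV_theory.
Context {R : realType}.
Notation leb := (@lebesgue_measure R).

Lemma measurable_addr (a : R) :
  measurable_fun [set: measurableTypeR R]
    ((fun x : R => x + a) : measurableTypeR R -> measurableTypeR R).
Proof. by apply: measurable_funD. Qed.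

Lemma lebesgue_measure_shift (a : R) (A : set (measurableTypeR R)) :
  measurable A -> leb ((fun x : R => x + a) @^-1` A) = leb A.
Proof.
move=> mA; apply/esym.
pose mu := mpushforward leb (@measurable_addr a).
rewrite -[RHS]/(mu A).
apply: lebesgue_measure_unique => // _ [[x y] _ <-].
rewrite /mu /= /pushforward.
have -> : (fun z : R => z + a) @^-1` `]x, y] = `]x - a, y - a]%classic.
  by apply/seteqP; split=> z /=; rewrite !in_itv/= ltrBlDr lerBrDr.
rewrite !lebesgue_measure_itv /= !lte_fin ltrD2r.
by case: ifP => // _; rewrite -!EFinB; congr EFin; ring.
Qed.

Lemma rV_cons0 n (p : R * 'rV[R]_n) : rV_cons p 0 ord0 = p.1.
Proof.
rewrite /rV_cons (_ : ord0 = lshift n (ord0 : 'I_1)); last exact: val_inj.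
by apply: (etrans (row_mxEl _ _ _ _)); rewrite mxE.
Qed.

Lemma rV_consS n (p : R * 'rV[R]_n) (i : 'I_n) :
  rV_cons p 0 (lift ord0 i) = p.2 0 i.
Proof.
rewrite /rV_cons (_ : lift ord0 i = rshift 1 i); last exact: val_inj.
exact: row_mxEr.
Qed.

Lemma lebesgue_rV_S n (A : set 'rV[R]_n.+1) :
  lebesgue_rV n.+1 A = (leb \x^ lebesgue_rV n)%E (@rV_cons R n @^-1` A).
Proof. by []. Qed.

Lemma measurable_cube n (J : set (measurableTypeR R)) : measurable J ->
  measurable [set x : 'rV[R]_n | forall i, J (x 0 i)].
Proof.
move=> mJ.
have -> : [set x : 'rV[R]_n | forall i, J (x 0 i)] =
    \bigcap_(i in [set: 'I_n]) (rV_coord i @^-1` J).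
  by apply/seteqP; split=> x /= H i; [move=> _|]; exact: H.
apply: fin_bigcap_measurable => [|i _]; first exact: finite_finset.
by rewrite -[X in measurable X]setTI; exact: measurable_rV_coord.
Qed.

Lemma lebesgue_rV_cube n (J : set (measurableTypeR R)) : measurable J ->
  lebesgue_rV n [set x : 'rV[R]_n | forall i, J (x 0 i)] = (leb J ^+ n)%E.
Proof.
move=> mJ; elim: n => [|n IH].
  by rewrite expe0 /= diracE mem_set// => -[].
rewrite lebesgue_rV_S.
have -> : @rV_cons R n @^-1` [set x | forall i, J (x 0 i)] =
    (J : set R) `*` [set x : 'rV[R]_n | forall i, (J : set R) (x 0 i)].
  apply/seteqP; split=> -[a x] /= H.
    split; first by have := H ord0; rewrite rV_cons0.
    by move=> i; have := H (lift ord0 i); rewrite rV_consS.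
  move=> i; case: H => Ja Jx.
  by case: (unliftP ord0 i) => [j ->|->]; rewrite ?rV_consS ?rV_cons0.
by rewrite product_measure2E ?IH ?expeS//; exact: measurable_cube.
Qed.

Lemma lebesgue_rV_sigma_finite n : sigma_finite setT (@lebesgue_rV R n).
Proof.
exists (fun k => [set x : 'rV[R]_n | forall i, (`[- k%:R, k%:R]%classic : set R) (x 0 i)]).
  apply/esym; rewrite -subTset => x _.
  pose M := \sum_i `|x 0 i|.
  have [k Mk] : exists k : nat, M <= k%:R.
    by exists (Num.bound M); apply/ltW/archi_boundP; rewrite /M sumr_ge0.
  exists k => // i /=; rewrite in_itv/= -ler_norml (le_trans _ Mk)//.
  by rewrite /M (bigD1 i)//= lerDl sumr_ge0.
move=> k; split; last first.
  rewrite lebesgue_rV_cube// lebesgue_measure_itv/= lte_fin.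
  by case: ifP => _; rewrite -?EFinB -EFin_expe ltry.
exact: measurable_cube.
Qed.

(** Lebesgue measure on R^n as a sigma-finite measure, so that Tonelli's theorem
    applies to it. *)
Definition lebesgue_rV_sf n : set 'rV[R]_n -> \bar R := lebesgue_rV n.

HB.instance Definition _ n := Measure.copy (@lebesgue_rV_sf n)
  (Measure.sort (lebesgue_rV n)).

HB.instance Definition _ n := @Measure_isSigmaFinite.Build _ _ _
  (@lebesgue_rV_sf n) (@lebesgue_rV_sigma_finite n).

Lemma addr_deltaE n (i : 'I_n) (s : R) (x : 'rV[R]_n) j :
  (x + s *: delta_mx 0 i) 0 j = x 0 j + s * (j == i)%:R.
Proof. by rewrite !mxE eqxx. Qed.

(** Translation of the i-th coordinate of x by g x. *)
Definition shear n (i : 'I_n) (g : 'rV[R]_n -> R) (x : 'rV[R]_n) : 'rV[R]_n :=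
  x + g x *: delta_mx 0 i.

Lemma shearE n (i : 'I_n) g (x : 'rV[R]_n) j :
  shear i g x 0 j = x 0 j + g x * (j == i)%:R.
Proof. exact: addr_deltaE. Qed.

Lemma measurable_shear n (i : 'I_n) (g : 'rV[R]_n -> R) :
  measurable_fun setT g -> measurable_fun setT (shear i g).
Proof.
move=> mg; apply: measurable_fun_rVP => j.
under eq_fun do rewrite shearE.
apply: measurable_funD; first exact: measurable_rV_coord.
exact: measurable_funM.
Qed.

(** A measurable shear whose amplitude does not depend on the sheared coordinate
    preserves Lebesgue measure. By induction on the dimension: if the first
    coordinate is sheared, each slice with the other coordinates fixed is
    translated; otherwise each slice with the first coordinate fixed is sheared. *)
Lemma lebesgue_rV_shear n (i : 'I_n) (g : 'rV[R]_n -> R) (A : set 'rV[R]_n) :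
  measurable_fun setT g -> (forall x s, g (x + s *: delta_mx 0 i) = g x) ->
  measurable A -> lebesgue_rV n (shear i g @^-1` A) = lebesgue_rV n A.
Proof.
elim: n i g A => [[]//|n IH] i g A mg gi mA.
have mB : measurable (shear i g @^-1` A).
  by rewrite -[X in measurable X]setTI; exact: measurable_shear.
have mcA (C : set 'rV[R]_n.+1) : measurable C ->
    measurable (@rV_cons R n @^-1` C).
  by move=> mC; rewrite -[X in measurable X]setTI; exact: measurable_rV_cons.
rewrite !lebesgue_rV_S.
case: (unliftP ord0 i) => [j ij|i0]; last first.
  apply: eq_integral => y _ /=.
  pose a := g (rV_cons (0, y)).
  rewrite -(@lebesgue_measure_shift a (ysection (@rV_cons R n @^-1` A) y)); last first.
    by apply: measurable_ysection; exact: mcA.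
  congr (leb _); apply/seteqP.
  suff E x : shear i g (rV_cons (x, y)) = rV_cons (x + a, y).
    by split=> x; rewrite /ysection /= !inE /= E.
  have gE : g (rV_cons (x, y)) = a.
    rewrite -(gi _ (- x)); congr g; apply/rowP => k; rewrite addr_deltaE i0.
    case: (unliftP ord0 k) => [k' ->|->]; rewrite ?rV_consS ?rV_cons0 /=.
      by rewrite mulr0 addr0.
    by rewrite ?eqxx mulr1 subrr.
  apply/rowP => k; rewrite shearE gE i0.
  case: (unliftP ord0 k) => [k' ->|->]; rewrite ?rV_consS ?rV_cons0 /=.
    by rewrite mulr0 addr0.
  by rewrite ?eqxx mulr1.
(* Tonelli: both orders of integration define the product measure. *)
pose lam : {sigma_finite_measure set 'rV[R]_n -> \bar R} := @lebesgue_rV_sf n.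
have sw C : measurable C ->
    (leb \x^ lebesgue_rV n)%E C = (leb \x lam)%E C.
  move=> mC; apply/esym.
  apply: (@product_measure_unique _ _ _ _ _ leb lam) => // A' B' mA' mB'.
  by rewrite -[RHS]/((leb A' * lebesgue_rV n B')%E) -product_measure2E.
rewrite !sw; try exact: mcA.
apply: eq_integral => x _ /=.
rewrite -[LHS]/(lebesgue_rV n _) -[RHS]/(lebesgue_rV n _).
pose gx y := g (rV_cons (x, y)).
rewrite -(IH j gx (xsection (@rV_cons R n @^-1` A) x)).
- congr (lebesgue_rV n _); apply/seteqP.
  suff E y : shear i g (rV_cons (x, y)) = rV_cons (x, shear j gx y).
    by split=> y; rewrite /xsection /= !inE /= E.
  apply/rowP => k; rewrite shearE ij.
  case: (unliftP ord0 k) => [k' ->|->]; rewrite ?rV_consS ?rV_cons0 /=.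
    by rewrite shearE (inj_eq lift_inj).
  by rewrite mulr0 addr0.
- apply: measurableT_comp => //.
  apply: (measurableT_comp (@measurable_rV_cons R n)).
  exact: pair1_measurable.
- move=> y s; rewrite /gx -(gi (rV_cons (x, y)) s); congr g.
  apply/rowP => k; rewrite addr_deltaE ij.
  case: (unliftP ord0 k) => [k' ->|->]; rewrite ?rV_consS ?rV_cons0 /=.
    by rewrite addr_deltaE (inj_eq lift_inj).
  by rewrite mulr0 addr0.
- by apply: measurable_xsection; exact: mcA.
Qed.

End lebesgue_rV_theory.

(** * Rotations and the surface measure *)

Section rotations.
Context {R : realType} {n : nat}.
Implicit Types (i j : 'I_n) (x : 'rV[R]_n).

(** The linear map with matrix (c, -s; s, c) in the plane of the coordinates i
    and j; it is a rotation when c^2 + s^2 = 1. *)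
Definition plane_rot i j (c s : R) x : 'rV[R]_n :=
  \row_k (if k == i then c * x 0 i - s * x 0 j
          else if k == j then s * x 0 i + c * x 0 j else x 0 k).

Lemma rotEl i j c s x : plane_rot i j c s x 0 i = c * x 0 i - s * x 0 j.
Proof. by rewrite mxE eqxx. Qed.

Lemma rotEr i j c s x : i != j -> plane_rot i j c s x 0 j = s * x 0 i + c * x 0 j.
Proof. by move=> ij; rewrite mxE eq_sym (negbTE ij) eqxx. Qed.

Lemma measurable_rot i j c s : measurable_fun setT (plane_rot i j c s).
Proof.
apply: measurable_fun_rVP => k.
rewrite (_ : (fun x => plane_rot i j c s x 0 k) = fun x : 'rV[R]_n =>
    if k == i then c * x 0 i - s * x 0 j
    else if k == j then s * x 0 i + c * x 0 j else x 0 k); last first.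
  by apply/funext => x; rewrite mxE.
case: (k == i); last case: (k == j).
- apply: measurable_funB; apply: measurable_funM => //;
  exact: measurable_rV_coord.
- apply: measurable_funD; apply: measurable_funM => //;
  exact: measurable_rV_coord.
- exact: measurable_rV_coord.
Qed.

Lemma dotp_rot i j c s x : i != j -> c ^+ 2 + s ^+ 2 = 1 ->
  dotp (plane_rot i j c s x) (plane_rot i j c s x) = dotp x x.
Proof.
move=> ij cs; rewrite /dotp.
rewrite (bigD1 i)//= [in RHS](bigD1 i)//=.
rewrite (bigD1 j) 1?eq_sym//= [in RHS](bigD1 j) 1?eq_sym//=.
rewrite !addrA; congr (_ + _); last first.
  by apply: eq_bigr => k /andP[ki kj]; rewrite mxE (negbTE ki) (negbTE kj).
rewrite rotEl rotEr//.
transitivity ((c ^+ 2 + s ^+ 2) * (x 0 i * x 0 i + x 0 j * x 0 j)); first by ring.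
by rewrite cs mul1r.
Qed.

Lemma enorm_rot i j c s x : i != j -> c ^+ 2 + s ^+ 2 = 1 ->
  enorm (plane_rot i j c s x) = enorm x.
Proof. by move=> ij cs; rewrite /enorm dotp_rot. Qed.

Lemma normalize_rot i j c s x : i != j -> c ^+ 2 + s ^+ 2 = 1 ->
  normalize (plane_rot i j c s x) = plane_rot i j c s (normalize x).
Proof.
move=> ij cs; rewrite /normalize enorm_rot//; apply/rowP => k; rewrite !mxE.
by case: ifP => _; [ring|case: ifP => _ //; ring].
Qed.

(** A rotation of angle other than pi is a composite of three shears; with
    angle theta the amplitudes are - tan (theta / 2), sin theta and again
    - tan (theta / 2). *)
Lemma rot_shears i j c s x : i != j -> c ^+ 2 + s ^+ 2 = 1 -> 1 + c != 0 ->
  plane_rot i j c s x = shear i (fun y => - s / (1 + c) * y 0 j)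
    (shear j (fun y => s * y 0 i) (shear i (fun y => - s / (1 + c) * y 0 j) x)).
Proof.
move=> ij cs c1; have ji : j != i by rewrite eq_sym.
set a := - s / (1 + c).
have a1 : s * a = c - 1.
  rewrite /a; have -> : s * (- s / (1 + c)) = - s ^+ 2 / (1 + c) by ring.
  have -> : s ^+ 2 = (1 - c) * (1 + c) by apply: (addrI (c ^+ 2)); rewrite cs; ring.
  by field.
have a2 : a * (1 + c) = - s by rewrite /a divfK.
apply/rowP => k; rewrite mxE; do 3 rewrite ?shearE /=.
rewrite !eqxx ?(negbTE ij) ?(negbTE ji) ?mulr0 ?addr0 ?mulr1.
have [->|ki] := eqVneq k i.
  rewrite (negbTE ij) !mulr0 !mulr1 !addr0.
  transitivity ((1 + s * a) * x 0 i + (a * (1 + (1 + s * a))) * x 0 j); last by ring.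
  by rewrite a1 addrCA subrr addr0 a2; ring.
have [->|kj] := eqVneq k j; last by rewrite !mulr0 !addr0.
rewrite !mulr0 !mulr1 !addr0.
transitivity (s * x 0 i + (1 + s * a) * x 0 j); last by ring.
by rewrite a1; ring.
Qed.

Lemma lebesgue_rV_rot i j c s (A : set 'rV[R]_n) :
  i != j -> c ^+ 2 + s ^+ 2 = 1 -> 1 + c != 0 -> measurable A ->
  lebesgue_rV n (plane_rot i j c s @^-1` A) = lebesgue_rV n A.
Proof.
move=> ij cs c1 mA; have ji : j != i by rewrite eq_sym.
pose g a k : 'rV[R]_n -> R := fun y => a * y 0 k.
have mg a k : measurable_fun setT (g a k).
  by apply: measurable_funM => //; exact: measurable_rV_coord.
have gE a k l : k != l -> forall x r, g a k (x + r *: delta_mx 0 l) = g a k x.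
  by move=> kl x r; rewrite /g addr_deltaE (negbTE kl) mulr0 addr0.
have mS k h B : measurable_fun setT h -> measurable B ->
    measurable (shear k h @^-1` B).
  move=> mh mB; rewrite -[X in measurable X]setTI.
  exact: (@measurable_shear _ _ k h).
have -> : plane_rot i j c s @^-1` A = shear i (g (- s / (1 + c)) j) @^-1`
    (shear j (g s i) @^-1` (shear i (g (- s / (1 + c)) j) @^-1` A)).
  by apply/seteqP; split=> x /=; rewrite rot_shears.
set g1 := g _ j; set g2 := g s i.
have m1 : measurable (shear i g1 @^-1` A) by apply: mS => //; exact: mg.
have m2 : measurable (shear j g2 @^-1` (shear i g1 @^-1` A)).
  by apply: mS => //; exact: mg.
rewrite lebesgue_rV_shear//; [|exact: mg|exact: gE].
rewrite lebesgue_rV_shear//; [|exact: mg|exact: gE].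
by apply: lebesgue_rV_shear => //; [exact: mg|exact: gE].
Qed.

End rotations.

Section sphere_measure_theory.
Context {R : realType} {d : nat}.
Notation sigma := (@sphere_measure R d).
Notation n := d.+1.

Lemma sphere_measure_rot (i j : 'I_n) (c s : R) (A : set 'rV[R]_n) :
  i != j -> c ^+ 2 + s ^+ 2 = 1 -> 1 + c != 0 -> measurable A ->
  sigma (plane_rot i j c s @^-1` A) = sigma A.
Proof.
move=> ij cs c1 mA; rewrite !sphere_measureE; congr (_ * _)%E.
pose B : set 'rV[R]_n := [set x | A (normalize x) /\ 0 < enorm x <= 1].
have mB : measurable B.
  have -> : B = (normalize @^-1` A) `&` punctured_ball by [].
  apply: measurableI; last exact: measurable_punctured_ball.
  by rewrite -[X in measurable X]setTI; exact: measurable_normalize.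
have := lebesgue_rV_rot ij cs c1 mB; set lam := lebesgue_rV n.
rewrite /B => <-; congr (lam _).
by apply/seteqP; split=> x /=; rewrite enorm_rot// normalize_rot.
Qed.

Lemma coord_le_enorm (x : 'rV[R]_n) i : `|x 0 i| <= enorm x.
Proof.
rewrite -sqrtr_sqr; apply: ler_wsqrtr; rewrite /dotp (bigD1 i)//= -expr2.
by rewrite lerDl sumr_ge0// => k _; rewrite -expr2 sqr_ge0.
Qed.

Lemma sphere_coord (w : 'rV[R]_n) i : sphere w -> `|w 0 i| <= 1.
Proof. by move=> <-; exact: coord_le_enorm. Qed.

Lemma sqr_enorm (x : 'rV[R]_n) : enorm x ^+ 2 = dotp x x.
Proof. by rewrite sqr_sqrtr// sumr_ge0// => k _; rewrite -expr2 sqr_ge0. Qed.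

Lemma sphere_dotp (w : 'rV[R]_n) : sphere w -> dotp w w = 1.
Proof. by rewrite /sphere /= -sqr_enorm => ->; rewrite expr1n. Qed.

Lemma measurable_sphere : measurable (@sphere R d).
Proof.
rewrite (_ : @sphere R d = enorm @^-1` [set 1]).
  by rewrite -[X in measurable X]setTI; exact: measurable_enorm.
by apply/seteqP; split=> x.
Qed.

(** The unit ball is contained in a cube. *)
Lemma sphere_measure_fin : (sigma setT < +oo)%E.
Proof.
rewrite sphere_measureE.
have mP := @measurable_punctured_ball R n.
have -> : [set x : 'rV[R]_n | setT (normalize x) /\ 0 < enorm x <= 1] = punctured_ball.
  by apply/seteqP; split=> x // -[].
pose J : set R := `[-1, 1]%classic.
pose C : set 'rV[R]_n := [set x | forall i, J (x 0 i)].
have mJ : measurable (J : set (measurableTypeR R)) by exact: measurable_itv.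
have mC : measurable C by exact: (measurable_cube (n := n) mJ).
have le : (lebesgue_rV n punctured_ball <= lebesgue_rV n C)%E.
  apply: le_measure; [exact/mem_set|exact/mem_set|].
  move=> x /andP[_ x1] i; rewrite /J /= in_itv/= -ler_norml.
  exact: le_trans (coord_le_enorm x i) x1.
have lJ : lebesgue_measure (J : set (measurableTypeR R)) = 2%:E.
  rewrite lebesgue_measure_itv /= lte_fin (_ : -1 < 1 :> R); last by lra.
  by rewrite -EFinB opprK.
move: le; rewrite /C lebesgue_rV_cube// lJ -EFin_expe => le.
by rewrite lte_mul_pinfty ?lee_fin// (le_lt_trans le)// ltry.
Qed.

(** The unit ball contains the cube (0, 1/n]^n, which avoids the origin. *)
Lemma sphere_area_gt0 : 0 < @sphere_area R d.
Proof.
apply: fine_gt0; rewrite sphere_measure_fin andbT sphere_measureE.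
rewrite mule_gt0 ?lte_fin//.
have mP := @measurable_punctured_ball R n.
have -> : [set x : 'rV[R]_n | setT (normalize x) /\ 0 < enorm x <= 1] = punctured_ball.
  by apply/seteqP; split=> x // -[].
pose r : R := n%:R^-1.
have r0 : 0 < r by rewrite invr_gt0.
pose J : set R := `]0, r]%classic.
pose C : set 'rV[R]_n := [set x | forall i, J (x 0 i)].
have mJ : measurable (J : set (measurableTypeR R)) by exact: measurable_itv.
have mC : measurable C by exact: (measurable_cube (n := n) mJ).
have : (lebesgue_rV n C <= lebesgue_rV n punctured_ball)%E.
  apply: le_measure; [exact/mem_set|exact/mem_set|].
  move=> x xr; rewrite /punctured_ball/=; apply/andP; split.
    rewrite sqrtr_gt0 /dotp (bigD1 ord0)//=.
    have := xr ord0; rewrite /J /= in_itv/= => /andP[x0 _].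
    apply: ltr_pwDl; first exact: mulr_gt0.
    by apply: sumr_ge0 => k _; rewrite -expr2 sqr_ge0.
  rewrite -[1]sqrtr1; apply: ler_wsqrtr.
  have -> : 1 = \sum_(i < n) r by rewrite sumr_const card_ord -mulr_natr mulVf.
  apply: ler_sum => i _; have := xr i; rewrite /J /= in_itv/= => /andP[x0 x1].
  rewrite (le_trans _ x1)// ler_piMl ?(ltW x0)// (le_trans x1)//.
  by rewrite invf_le1 ?ler1n.
have lJ : lebesgue_measure (J : set (measurableTypeR R)) = r%:E.
  by rewrite lebesgue_measure_itv /= lte_fin r0 -EFinB subr0.
apply: lt_le_trans; rewrite /C lebesgue_rV_cube// lJ.
by rewrite -EFin_expe lte_fin exprn_gt0.
Qed.

End sphere_measure_theory.

(** * Integration of functions bounded on the sphere *)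

Section spherical_integral.
Context {R : realType} {d : nat}.
Notation sigma := (@sphere_measure R d).
Notation n := d.+1.
Implicit Types f g : 'rV[R]_n -> R.

(** Measurable functions that are bounded on the sphere; nothing is asked of
    their size off the sphere, which is negligible. *)
Definition sbounded f :=
  measurable_fun setT f /\ exists M, forall w, sphere w -> `|f w| <= M.

Lemma sbounded_cst c : sbounded (fun=> c).
Proof. by split => //; exists `|c|. Qed.

Lemma sbounded_coord i : sbounded (fun w => w 0 i).
Proof.
split; first exact: measurable_rV_coord.
by exists 1 => w; exact: sphere_coord.
Qed.

Lemma sboundedD f g : sbounded f -> sbounded g -> sbounded (fun w => f w + g w).
Proof.
move=> [mf [M fM]] [mg [N gN]]; split; first exact: measurable_funD.
by exists (M + N) => w sw; rewrite (le_trans (ler_normD _ _))// lerD ?fM ?gN.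
Qed.

Lemma sboundedM f g : sbounded f -> sbounded g -> sbounded (fun w => f w * g w).
Proof.
move=> [mf [M fM]] [mg [N gN]]; split; first exact: measurable_funM.
by exists (M * N) => w sw; rewrite normrM ler_pM// ?fM ?gN.
Qed.

Lemma sboundedB f g : sbounded f -> sbounded g -> sbounded (fun w => f w - g w).
Proof.
move=> [mf [M fM]] [mg [N gN]]; split; first exact: measurable_funB.
by exists (M + N) => w sw; rewrite (le_trans (ler_normB _ _))// lerD ?fM ?gN.
Qed.

Lemma sboundedX f k : sbounded f -> sbounded (fun w => f w ^+ k).
Proof.
move=> sf; elim: k => [|k IH]; first exact: sbounded_cst.
by under eq_fun do rewrite exprS; exact: sboundedM.
Qed.

Lemma sbounded_sum (I : Type) (r : seq I) (F : I -> 'rV[R]_n -> R) :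
  (forall i, sbounded (F i)) -> sbounded (fun w => \sum_(i <- r) F i w).
Proof.
move=> sF; elim: r => [|i r IH].
  by under eq_fun do rewrite big_nil; exact: sbounded_cst.
by under eq_fun do rewrite big_cons; exact: sboundedD.
Qed.

Lemma sbounded_integrable f : sbounded f -> sigma.-integrable setT (EFin \o f).
Proof.
move=> [mf [M fM]]; have mS := @measurable_sphere R d.
have mf' : measurable_fun setT (EFin \o f) by exact/measurable_EFinP.
have mT : measurable [set: 'rV[R]_n] by exact: measurableT.
apply/(negligible_integrable (measurableC mS) mT mf'
  (@sphere_measure_setC R d)).
rewrite setDE setTI setCK; apply: measurable_bounded_integrable => //.
- apply: le_lt_trans (@sphere_measure_fin R d).
  by apply: le_measure; rewrite ?inE.
- exact: measurable_funTS.
exists M; split; first exact: num_real.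
by move=> x Mx w sw; exact: le_trans (fM w sw) (ltW Mx).
Qed.

Lemma ae_sphere (P : 'rV[R]_n -> Prop) :
  (forall w, sphere w -> P w) -> {ae sigma, forall w, P w}.
Proof.
move=> SP; exists (~` (@sphere R d)); split.
- by apply: measurableC; exact: measurable_sphere.
- exact: sphere_measure_setC.
- by move=> w /= nP sw; apply: nP; exact: SP.
Qed.

Lemma sint_eq f g : measurable_fun setT f -> measurable_fun setT g ->
  (forall w, sphere w -> f w = g w) -> \int[sigma]_w f w = \int[sigma]_w g w.
Proof.
move=> mf mg fg; congr fine; apply: ae_eq_integral => //.
- exact/measurable_EFinP.
- exact/measurable_EFinP.
- by apply: ae_sphere => w sw _; rewrite /= fg.
Qed.

Lemma sint_cst (c : R) : \int[sigma]_w c = c * @sphere_area R d.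
Proof. exact: Rintegral_cst. Qed.

Lemma sintD f g : sbounded f -> sbounded g ->
  \int[sigma]_w (f w + g w) = \int[sigma]_w f w + \int[sigma]_w g w.
Proof. by move=> sf sg; apply: RintegralD => //; exact: sbounded_integrable. Qed.

Lemma sintB f g : sbounded f -> sbounded g ->
  \int[sigma]_w (f w - g w) = \int[sigma]_w f w - \int[sigma]_w g w.
Proof. by move=> sf sg; apply: RintegralB => //; exact: sbounded_integrable. Qed.

Lemma sintZ f c : sbounded f ->
  \int[sigma]_w (c * f w) = c * \int[sigma]_w f w.
Proof. by move=> sf; apply: RintegralZl => //; exact: sbounded_integrable. Qed.

Lemma sint_sum (I : Type) (r : seq I) (F : I -> 'rV[R]_n -> R) :
  (forall i, sbounded (F i)) ->
  \int[sigma]_w (\sum_(i <- r) F i w) = \sum_(i <- r) \int[sigma]_w F i w.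
Proof.
move=> sF; elim: r => [|i r IH].
  rewrite big_nil; under eq_Rintegral do rewrite big_nil.
  by rewrite sint_cst mul0r.
rewrite big_cons -IH -sintD//; last exact: sbounded_sum.
by apply: eq_Rintegral => w _; rewrite big_cons.
Qed.

Lemma sint_norm_le f (M : R) : sbounded f ->
  (forall w, sphere w -> `|f w| <= M) ->
  `|\int[sigma]_w f w| <= M * @sphere_area R d.
Proof.
move=> sf fM; have mS := @measurable_sphere R d.
have nf : sbounded (fun w => `|f w|).
  case: sf => mf _; split; first exact: measurableT_comp.
  by exists M => w sw; rewrite normr_id fM.
apply: (le_trans (le_normr_Rintegral _ _)) => //; first exact: sbounded_integrable.
(* The truncation of |f| at M agrees with |f| on the sphere. *)
pose g w := if `|f w| <= M then `|f w| else M.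
have mg : measurable_fun setT g.
  rewrite (_ : g = (fun w => Num.min `|f w| M)).
    by apply: measurable_minr => //; case: nf.
  by apply/funext => w; rewrite /g minEle.
have sg : sbounded g.
  split => //; exists M => w sw; rewrite /g fM// normr_id; exact: fM.
rewrite (@sint_eq _ g) => //; last first.
- by move=> w sw; rewrite /g fM.
- by case: nf.
rewrite -sint_cst; apply: le_Rintegral => //.
- exact: sbounded_integrable.
- exact/sbounded_integrable/sbounded_cst.
- by move=> w _; rewrite /g; case: ifP.
Qed.

Lemma sbounded_rot i j (c s : R) f : i != j -> c ^+ 2 + s ^+ 2 = 1 ->
  sbounded f -> sbounded (fun w => f (plane_rot i j c s w)).
Proof.
move=> ij cs [mf [M fM]]; split.
  by apply: measurableT_comp => //; exact: measurable_rot.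
by exists M => w sw; apply: fM; rewrite /sphere/= enorm_rot.
Qed.

Lemma sint_rot i j (c s : R) f :
  i != j -> c ^+ 2 + s ^+ 2 = 1 -> 1 + c != 0 -> sbounded f ->
  \int[sigma]_w f (plane_rot i j c s w) = \int[sigma]_w f w.
Proof.
move=> ij cs c1 sf; congr fine.
pose mu := mpushforward sigma (@measurable_rot R n i j c s).
transitivity (\int[mu]_w (f w)%:E)%E; last first.
  by apply: eq_measure_integral => A mA _; exact: sphere_measure_rot.
rewrite integral_pushforward//.
- exact: measurable_rot.
- by apply/measurable_EFinP; case: sf.
- exact: sbounded_integrable (sbounded_rot ij cs sf).
Qed.

End spherical_integral.

(** * Moments of the coordinates *)

Section moments.
Context {R : realType} {d : nat}.
Context (d0 : (0 < d)%N).
Notation sigma := (@sphere_measure R d).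
Notation n := d.+1.
Notation A := (@sphere_area R d).
Implicit Types i j : 'I_n.

Let sbX i k : sbounded (fun w : 'rV[R]_n => w 0 i ^+ k).
Proof. exact/sboundedX/sbounded_coord. Qed.

Let another i : exists j, i != j.
Proof.
have [i0|i0] := eqVneq i ord0; last by exists ord0.
by exists ord_max; rewrite i0 -val_eqE/= eq_sym -lt0n.
Qed.

Let cs01 : 0 ^+ 2 + 1 ^+ 2 = 1 :> R.
Proof. by rewrite expr0n expr1n add0r. Qed.

Let c01 : 1 + 0 != 0 :> R.
Proof. by rewrite addr0 oner_neq0. Qed.

Let quarter_turn i j k : i != j ->
  \int[sigma]_w (w 0 i ^+ k) = \int[sigma]_w ((- w 0 j) ^+ k).
Proof.
move=> ij; rewrite -(sint_rot ij cs01 c01 (sbX i k)).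
by apply: eq_Rintegral => w _; rewrite rotEl mul0r mul1r add0r.
Qed.

(** Two quarter turns change the sign of a coordinate. *)
Lemma sint_coordX_odd i k : odd k -> \int[sigma]_w (w 0 i ^+ k) = 0.
Proof.
move=> ok; have [j ij] := another i; have ji : j != i by rewrite eq_sym.
have N l : \int[sigma]_w ((- w 0 l) ^+ k) = - \int[sigma]_w (w 0 l ^+ k).
  rewrite -mulN1r -sintZ//; apply: eq_Rintegral => w _.
  by rewrite exprNn -signr_odd ok.
pose f (w : 'rV[R]_n) := (- w 0 j) ^+ k.
have sf : sbounded f.
  apply: sboundedX; under eq_fun do rewrite -mulN1r.
  by apply: sboundedM; [exact: sbounded_cst|exact: sbounded_coord].
have : \int[sigma]_w f w = \int[sigma]_w ((- w 0 i) ^+ k).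
  rewrite -(sint_rot ij cs01 c01 sf).
  by apply: eq_Rintegral => w _; rewrite /f rotEr// mul0r mul1r addr0.
by rewrite /f -(quarter_turn k ij) N => E; lra.
Qed.

Lemma sint_coordX_even i j k :
  \int[sigma]_w (w 0 i ^+ k.*2) = \int[sigma]_w (w 0 j ^+ k.*2).
Proof.
have [->//|ij] := eqVneq i j; rewrite (quarter_turn _ ij).
by apply: eq_Rintegral => w _; rewrite -mul2n !exprM sqrrN.
Qed.

(** The squares of the coordinates sum to 1 on the sphere. *)
Lemma sint_coord2 i : \int[sigma]_w (w 0 i ^+ 2) = A / (d%:R + 1).
Proof.
have : \int[sigma]_w (\sum_j w 0 j ^+ 2) = A.
  rewrite -[RHS]mul1r -sint_cst; apply: sint_eq => //.
  - by case: (@sbounded_sum R d _ (index_enum 'I_n) _ (fun j => @sbX j 2)).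
  - move=> w sw; rewrite -(sphere_dotp sw) /dotp.
    by apply: eq_bigr => j _; rewrite expr2.
rewrite sint_sum//.
rewrite (eq_bigr (fun=> \int[sigma]_w (w 0 i ^+ 2))); last first.
  by move=> j _; exact: (@sint_coordX_even j i 1).
rewrite sumr_const card_ord -[X in X = A]mulr_natr natr1 => <-.
by rewrite mulfK// pnatr_eq0.
Qed.

(** The rotation by an eighth of a turn maps the product of two coordinates to
    half the difference of their squares, so that the mixed moment M and the
    fourth moment m satisfy M = (2 m - 2 M) / 4. *)
Lemma sint_coord22 i j : i != j ->
  \int[sigma]_w (w 0 i ^+ 2 * w 0 j ^+ 2) = (\int[sigma]_w (w 0 i ^+ 4)) / 3.
Proof.
move=> ij; pose c : R := Num.sqrt 2^-1.
have c2 : c ^+ 2 = 2^-1 by rewrite sqr_sqrtr.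
have sM : sbounded (fun w : 'rV[R]_n => w 0 i ^+ 2 * w 0 j ^+ 2) by exact: sboundedM.
have cc : c ^+ 2 + c ^+ 2 = 1 by rewrite c2; lra.
have c1 : 1 + c != 0 by rewrite gt_eqF// ltr_pwDl// sqrtr_ge0.
have /esym := sint_rot ij cc c1 sM.
have -> : \int[sigma]_w (plane_rot i j c c w 0 i ^+ 2 * plane_rot i j c c w 0 j ^+ 2) =
   \int[sigma]_w (4^-1 * ((w 0 i ^+ 4 + w 0 j ^+ 4) - 2 * (w 0 i ^+ 2 * w 0 j ^+ 2))).
  apply: eq_Rintegral => w _; rewrite rotEl rotEr//.
  transitivity ((c ^+ 2) ^+ 2 * ((w 0 i ^+ 4 + w 0 j ^+ 4) -
    2 * (w 0 i ^+ 2 * w 0 j ^+ 2))); first by ring.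
  by rewrite c2; congr (_ * _); field.
have s2 : sbounded (fun w : 'rV[R]_n => 2 * (w 0 i ^+ 2 * w 0 j ^+ 2)).
  by apply: sboundedM => //; exact: sbounded_cst.
have s4 : sbounded (fun w : 'rV[R]_n => w 0 i ^+ 4 + w 0 j ^+ 4) by exact: sboundedD.
rewrite sintZ; last exact: sboundedB.
rewrite sintB// sintD// sintZ//.
rewrite (@sint_coordX_even j i 2).
lra.
Qed.

(** Multiply the second moment by the sum of the squared coordinates. *)
Lemma sint_coord4 i :
  \int[sigma]_w (w 0 i ^+ 4) = 3 * A / ((d%:R + 1) * (d%:R + 3)).
Proof.
set m4 := Rintegral _ _ _.
have s22 j : sbounded (fun w : 'rV[R]_n => w 0 i ^+ 2 * w 0 j ^+ 2) by exact: sboundedM.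
have : \int[sigma]_w (\sum_j w 0 i ^+ 2 * w 0 j ^+ 2) = A / (d%:R + 1).
  rewrite -(sint_coord2 i); apply: sint_eq => //.
  - by case: (@sbounded_sum R d _ (index_enum 'I_n) _ s22).
  - by case: (sbX i 2).
  - move=> w sw; rewrite -mulr_sumr.
    rewrite (_ : \sum_(j < n) w 0 j ^+ 2 = 1) ?mulr1// -(sphere_dotp sw) /dotp.
    by apply: eq_bigr => j _; rewrite expr2.
rewrite sint_sum// (bigD1 i)//=.
rewrite (eq_Rintegral sigma (g := fun w : 'rV[R]_n => w 0 i ^+ 4)); last first.
  by move=> w _; ring.
rewrite (eq_bigr (fun=> m4 / 3)); last first.
  by move=> j ji; rewrite sint_coord22// eq_sym.
rewrite sumr_const cardC1 card_ord /= -/m4 -[X in _ + X]mulr_natr => E.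
have d1 : d%:R + 1 != 0 :> R by rewrite natr1 pnatr_eq0.
have d3 : d%:R + 3 != 0 :> R by rewrite -natrD pnatr_eq0 addn3.
have -> : 3 * A / ((d%:R + 1) * (d%:R + 3)) = 3 / (d%:R + 3) * (A / (d%:R + 1)).
  by field; rewrite d1.
by rewrite -E; field.
Qed.

Lemma sbounded_quartic i (a0 a1 a2 a3 a4 : R) : sbounded (fun w : 'rV[R]_n =>
  a0 + a1 * w 0 i + a2 * w 0 i ^+ 2 + a3 * w 0 i ^+ 3 + a4 * w 0 i ^+ 4).
Proof.
have sZ a k : sbounded (fun w : 'rV[R]_n => a * w 0 i ^+ k).
  by apply: sboundedM => //; exact: sbounded_cst.
do 3 (apply: sboundedD; last exact: sZ).
by apply: sboundedD; [exact: sbounded_cst|exact: (sZ a1 1%N)].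
Qed.

Lemma sint_quartic i (a0 a1 a2 a3 a4 : R) :
  \int[sigma]_w (a0 + a1 * w 0 i + a2 * w 0 i ^+ 2 + a3 * w 0 i ^+ 3
                 + a4 * w 0 i ^+ 4) =
  A * (a0 + a2 / (d%:R + 1) + a4 * (3 / ((d%:R + 1) * (d%:R + 3)))).
Proof.
have sZ a k : sbounded (fun w : 'rV[R]_n => a * w 0 i ^+ k).
  by apply: sboundedM => //; exact: sbounded_cst.
have s0 : sbounded (fun _ : 'rV[R]_n => a0) by exact: sbounded_cst.
have s1 := sboundedD s0 (sZ a1 1%N).
have s2 := sboundedD s1 (sZ a2 2%N).
have s3 := sboundedD s2 (sZ a3 3%N).
rewrite (sintD s3 (sZ a4 4%N)) (sintD s2 (sZ a3 3%N)) (sintD s1 (sZ a2 2%N)).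
rewrite (sintD s0 (sZ a1 1%N)) sint_cst !(sintZ _ (sbX i _)).
rewrite sint_coord4 sint_coord2 (sint_coordX_odd i (k := 3))//.
rewrite (sint_coordX_odd i (k := 1))//.
by rewrite !mulr0 !addr0; ring.
Qed.

End moments.

(** * Binomial expansion of real powers *)

Section powR_taylor.
Context {R : realType}.
Implicit Types p s : R.

(** The generalized binomial coefficient p (p - 1) ... (p - k + 1) / k!. *)
Definition gbin p (k : nat) : R := (\prod_(i < k) (p - i%:R)) / k`!%:R.

Lemma gbin0 p : gbin p 0 = 1.
Proof. by rewrite /gbin big_ord0 fact0 divr1. Qed.

Lemma gbin1 p : gbin p 1 = p.
Proof. by rewrite /gbin big_ord1 subr0 divr1. Qed.

Lemma gbinS p k : gbin p k.+1 *+ k.+1 = p * gbin (p - 1) k.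
Proof.
rewrite /gbin big_ord_recl subr0 factS natrM -mulr_natr.
rewrite (eq_bigr (fun i : 'I_k => p - 1 - i%:R)); last first.
  by move=> i _; rewrite /= /bump /= add1n -natr1; ring.
have k0 : k`!%:R != 0 :> R by rewrite pnatr_eq0 -lt0n fact_gt0.
by field; rewrite k0 nat1r pnatr_eq0.
Qed.

(** The first N terms of the binomial series of exponent p. *)
Definition binpoly N p : {poly R} := \poly_(k < N) gbin p k.

Lemma deriv_binpoly N p : (binpoly N.+1 p)^`() = p *: binpoly N (p - 1).
Proof.
apply/polyP => k; rewrite coef_deriv coefZ !coef_poly ltnS.
by case: ifP => _; rewrite ?mul0rn ?mulr0// gbinS.
Qed.

Lemma powR_bound p s : `|s| <= 2^-1 -> `|(1 + s) `^ p| <= expR `|p|.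
Proof.
rewrite ler_norml => /andP[s1 s2].
have s0 : 0 < 1 + s by lra.
rewrite /powR gt_eqF// ger0_norm ?expR_ge0// ler_expR.
rewrite (le_trans (ler_norm _))// normrM ler_piMr// ler_norml; apply/andP; split.
  have v0 : 0 < (1 + s)^-1 by rewrite invr_gt0.
  have h1 : -1 < (1 + s)^-1 - 1 by lra.
  have := le_ln1Dx h1; rewrite addrC subrK lnV ?posrE// => h.
  have : (1 + s)^-1 <= 2.
    by rewrite -[2]invrK lef_pV2 ?posrE ?invr_gt0//; lra.
  lra.
have h1 : -1 < s by lra.
have := le_ln1Dx h1; lra.
Qed.

(** Newton's binomial series with remainder, by induction on the order: the
    derivative of the remainder for the exponent p is p times the previous
    remainder for the exponent p - 1. *)
Lemma powR_taylor N p : exists K, 0 <= K /\ forall s, `|s| <= 2^-1 ->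
  `|(1 + s) `^ p - (binpoly N p).[s]| <= K * `|s| ^+ N.
Proof.
elim: N p => [|N IH] p.
  exists (expR `|p|); split; first exact: expR_ge0.
  move=> s s1; rewrite /binpoly poly_def big_ord0 horner0 subr0 expr0 mulr1.
  exact: powR_bound.
have [K [K0 HK]] := IH (p - 1).
exists (`|p| * K); split; first by rewrite mulr_ge0.
pose F s := (1 + s) `^ p - (binpoly N.+1 p).[s].
pose dF s := p * ((1 + s) `^ (p - 1) - (binpoly N (p - 1)).[s]).
have dFP s : `|s| <= 2^-1 -> is_derive s 1 F (dF s).
  rewrite ler_norml => /andP[s1 s2].
  have s0 : 0 < 1 + s by lra.
  have d1 : is_derive s 1 (fun s : R => 1 + s) 1.
    by apply: is_derive_eq; rewrite add0r mulr1.
  have d2 : is_derive s 1 (fun s : R => (1 + s) `^ p) (p * (1 + s) `^ (p - 1) * 1).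
    exact: (@is_derive1_comp R (fun x : R => x `^ p) (fun s => 1 + s) s _ 1
      (is_derive1_powR p s0) d1).
  apply: is_derive_eq; rewrite deriv_binpoly hornerZ /dF; ring.
have F0 : F 0 = 0.
  by rewrite /F addr0 powR1 horner_coef0 coef_poly /= gbin0 subrr.
have key a b : a <= b -> `|a| <= 2^-1 -> `|b| <= 2^-1 ->
    exists2 c, a <= c <= b & F b - F a = dF c * (b - a).
  move=> ab; rewrite !ler_norml => /andP[a1 a2] /andP[b1 b2].
  have dd x : x \in `[a, b] -> is_derive x 1 F (dF x).
    by rewrite in_itv/= => /andP[ax xb]; apply: dFP; rewrite ler_norml; lra.
  have [c] : exists2 c, c \in `[a, b]%R & F b - F a = dF c * (b - a).
    have cF : {within `[a, b], continuous F}.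
      by apply: derivable_within_continuous => x /dd[].
    have doo x : x \in `]a, b[ -> is_derive x 1 F (dF x).
      by move=> xab; apply: dd; exact: subset_itv_oo_cc xab.
    exact: (@MVT_segment R F dF a b ab doo cF).
  by rewrite in_itv/= => cab E; exists c.
move=> s s1; rewrite -[leLHS]/`|F s|.
have [c cs Fs] : exists2 c, `|c| <= `|s| & F s = dF c * s.
  have [s0|s0] := leP 0 s.
    have [|c /andP[c0 cs]] := @key 0 s s0 _ s1; first by rewrite normr0 invr_ge0.
    by rewrite F0 !subr0 => E; exists c => //; rewrite !ger0_norm.
  have [|c /andP[sc c0]] := @key s 0 (ltW s0) s1; first by rewrite normr0 invr_ge0.
  rewrite F0 !sub0r => E; exists c; last by rewrite -[F s]opprK E mulrN opprK.
  by rewrite !ler0_norm ?lerN2 ?(ltW s0).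
rewrite Fs normrM /dF normrM exprSr !mulrA ler_wpM2r// -mulrA ler_wpM2l//.
apply: le_trans (HK _ (le_trans cs s1)) _.
by rewrite ler_wpM2l// lerXn2r ?nnegrE.
Qed.

End powR_taylor.

(** * Zonal polynomials in the Sobolev space *)

Section zonal.
Context {R : realType} {d : nat}.
Notation sigma := (@sphere_measure R d).
Notation n := d.+1.
Notation t w := (w 0 ord_max).
Implicit Types (p : {poly R}) (w : 'rV[R]_n).

(** The polynomial p in the last coordinate. *)
Definition zonal p w : R := p.[t w].

Lemma continuous_zonal p : continuous (zonal p).
Proof.
move=> w; apply: (@continuous_comp _ _ _ (fun w => t w) (horner p)).
  exact: coord_continuous.
exact: continuous_horner.
Qed.

Lemma is_derive_zonal p w (i : 'I_n) : is_derive w (delta_mx 0 i) (zonal p)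
  (zonal ((i == ord_max)%:R *: p^`()) w).
Proof.
have tE h : t (h *: delta_mx 0 i + w) = h * (i == ord_max)%:R + t w.
  by rewrite !mxE eqxx eq_sym.
have E : (fun h : R => h^-1 *: ((zonal p \o shift w) (h *: delta_mx 0 i) - zonal p w)) =
    (fun h : R => h^-1 *: ((horner p \o shift (t w)) (h *: (i == ord_max)%:R) - p.[t w])).
  by apply/funext => h /=; rewrite /zonal tE.
have -> : zonal ((i == ord_max)%:R *: p^`()) w = 'D_((i == ord_max)%:R) (horner p) (t w).
  rewrite /zonal hornerZ; case: eqP => _ /=.
    by rewrite mul1r derive_val.
  by rewrite mul0r derive0.
split; last by rewrite /derive E.
rewrite /derivable E -/(derivable (horner p) (t w) _).
by case: eqP => _; [exact: derivable_horner|exact: derivable0].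
Qed.

Lemma partial_zonal p i :
  partial i (zonal p) = zonal ((i == ord_max)%:R *: p^`()).
Proof.
apply/funext => w; have D := is_derive_zonal p w i.
by rewrite /partial derive_val.
Qed.

Lemma smooth_zonal p : smooth (zonal p).
Proof.
move=> k; elim: k p => [|k IH] p /=; first exact: continuous_zonal.
move=> i; split; last by rewrite partial_zonal; exact: IH.
by move=> w; have [] := is_derive_zonal p w i.
Qed.

Lemma sbounded_zonal p : @sbounded R d (zonal p).
Proof.
have -> : zonal p = fun w => \sum_(i < size p) p`_i * t w ^+ i.
  by apply/funext => w; rewrite /zonal horner_coef.
apply: sbounded_sum => i; apply: sboundedM; first exact: sbounded_cst.
exact/sboundedX/sbounded_coord.
Qed.

Lemma sgrad_zonal p w i :
  sgrad (zonal p) w 0 i = zonal p^`() w * ((i == ord_max)%:R - t w * w 0 i).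
Proof.
rewrite /sgrad; set g := \row_i _.
have gE k : g 0 k = (k == ord_max)%:R * zonal p^`() w.
  by rewrite mxE partial_zonal /zonal hornerZ.
have -> : dotp g w = zonal p^`() w * t w.
  rewrite /dotp (bigD1 ord_max)//= gE eqxx mul1r big1 ?addr0// => k kt.
  by rewrite gE (negbTE kt) !mul0r.
have -> : (g - (zonal p^`() w * t w) *: w) 0 i = g 0 i - (zonal p^`() w * t w) * w 0 i.
  by rewrite !mxE.
by rewrite gE; ring.
Qed.

Lemma sbounded_sgrad p i : @sbounded R d (fun w => sgrad (zonal p) w 0 i).
Proof.
rewrite (_ : (fun w => _) = fun w => zonal p^`() w * ((i == ord_max)%:R - t w * w 0 i)).
  apply: sboundedM; first exact: sbounded_zonal.
  apply: sboundedB; first exact: sbounded_cst.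
  by apply: sboundedM; exact: sbounded_coord.
by apply/funext => w; rewrite sgrad_zonal.
Qed.

Lemma enorm_sgrad_zonal p w : sphere w ->
  enorm (sgrad (zonal p) w) ^+ 2 = zonal p^`() w ^+ 2 * (1 - t w ^+ 2).
Proof.
move=> sw; rewrite sqr_enorm /dotp.
rewrite (eq_bigr (fun i => zonal p^`() w ^+ 2 * ((i == ord_max)%:R * (1 - 2 * t w * t w)
   + t w ^+ 2 * (w 0 i * w 0 i)))); last first.
  move=> i _; rewrite sgrad_zonal; case: eqP => [->|_] /=; ring.
rewrite -mulr_sumr big_split/= -mulr_sumr -/(dotp w w) sphere_dotp//.
rewrite (bigD1 ord_max)//= eqxx big1 ?addr0 ?mul1r ?mulr1; first by ring.
by move=> i /negbTE ->; rewrite mul0r.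
Qed.

Lemma sbounded_enorm_sgrad p : @sbounded R d (fun w => enorm (sgrad (zonal p) w) ^+ 2).
Proof.
rewrite (_ : (fun w => _) = fun w => \sum_i sgrad (zonal p) w 0 i * sgrad (zonal p) w 0 i).
  by apply: sbounded_sum => i; apply: sboundedM; exact: sbounded_sgrad.
by apply/funext => w; rewrite sqr_enorm.
Qed.

Lemma sbounded_powR (f : 'rV[R]_n -> R) (q : R) : 0 <= q ->
  @sbounded R d f -> @sbounded R d (fun w => `|f w| `^ q).
Proof.
move=> q0 [mf [M fM]]; split.
  apply: (measurableT_comp (measurable_powR q)).
  exact: measurableT_comp.
exists (M `^ q) => w sw; rewrite ger0_norm ?powR_ge0//.
by apply: ge0_ler_powR => //; rewrite ?nnegrE ?(le_trans _ (fM w sw))// fM.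
Qed.

Lemma Lnorm_sbounded (f : 'rV[R]_n -> R) (q : R) : 0 < q -> @sbounded R d f ->
  ('N[sigma]_q%:E[EFin \o f])%E = ((\int[sigma]_w (`|f w| `^ q)) `^ q^-1)%:E.
Proof.
move=> q0 sf; rewrite unlock /= -poweR_EFin; congr (_ `^ _)%E.
rewrite fineK //; apply: integrable_fin_num => //.
exact: sbounded_integrable (sbounded_powR (ltW q0) sf).
Qed.

Lemma Lfun_sbounded (f : 'rV[R]_n -> R) (q : R) : 0 < q -> @sbounded R d f ->
  f \in Lfun sigma q%:E.
Proof.
move=> q0 sf; apply/andP; split; rewrite inE/=; first by case: sf.
by rewrite /finite_norm Lnorm_sbounded// ltry.
Qed.

Lemma H1_zonal p : H1 (zonal p) (sgrad (zonal p)).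
Proof.
split.
- by apply: Lfun_sbounded => //; exact: sbounded_zonal.
- by move=> i; apply: Lfun_sbounded => //; exact: sbounded_sgrad.
(* The function is smooth, hence the constant sequence approximates it. *)
exists (fun=> zonal p); split; first by move=> _; exact: smooth_zonal.
- under eq_fun do under eq_integral do rewrite subrr expr0n/=.
  by under eq_fun do rewrite integral0; exact: cvg_cst.
- rewrite (_ : (fun _ => _) = fun=> 0%E); first exact: cvg_cst.
  apply/funext => k; apply: integral0_eq => w _.
  by rewrite subrr sqr_enorm /dotp big1// => i _; rewrite mxE mul0r.
Qed.

End zonal.

(** * Norms of the test functions *)

Section quadratic.
Context {R : realType} {d : nat} (q : R).
Context (d0 : (0 < d)%N) (q2 : 2 < q).
Notation sigma := (@sphere_measure R d).
Notation n := d.+1.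
Notation t w := (w 0 ord_max).
Notation A := (@sphere_area R d).
Notation zon := (@zonal R d).
Notation m2 := ((d%:R + 1)^-1 : R).
Notation m4 := (3 / ((d%:R + 1) * (d%:R + 3)) : R).
Notation D := (d%:R / (q - 2)).
Implicit Types (w : 'rV[R]_n) (a b c eps : R).

Definition quad a0 a1 a2 : {poly R} := a0%:P + a1 *: 'X + a2 *: 'X^2.

Lemma zonal_quad a0 a1 a2 w :
  zon (quad a0 a1 a2) w = a0 + a1 * t w + a2 * t w ^+ 2.
Proof. by rewrite /zonal /quad !hornerE. Qed.

Lemma zonal_quad_deriv a0 a1 a2 w :
  zon (quad a0 a1 a2)^`() w = a1 + 2 * a2 * t w.
Proof.
by rewrite /zonal /quad !poly.derivE !hornerE /=; ring.
Qed.

(** Divided by the area, the squared H^1 norm of the zonal function of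
    [quad a0 a1 a2]; [m2] and [m4] are the normalized second and fourth moments
    of a coordinate. *)
Definition quad_energy a0 a1 a2 : R :=
  a1 ^+ 2 * (1 - m2) + 4 * a2 ^+ 2 * (m2 - m4)
  + D * (a0 ^+ 2 + (a1 ^+ 2 + 2 * a0 * a2) * m2 + a2 ^+ 2 * m4).

(** The constant coefficients are unrelated because the gradient does not see
    them; this covers the subtraction of the mean. *)
Lemma H1norm_quad a0 a1 a2 b :
  H1norm q (zon (quad a0 a1 a2)) (sgrad (zon (quad b a1 a2))) ^+ 2 =
  A * quad_energy a0 a1 a2.
Proof.
have D0 : 0 <= D by rewrite divr_ge0 ?ler0n// subr_ge0 ltW.
rewrite sqr_sqrtr; last first.
  apply: Rintegral_ge0 => w _; apply: addr_ge0; first exact: sqr_ge0.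
  by apply: mulr_ge0 => //; exact: sqr_ge0.
rewrite (@sint_eq _ _ _ (fun w => (a1 ^+ 2 + D * a0 ^+ 2)
  + (4 * a1 * a2 + 2 * D * a0 * a1) * t w
  + (4 * a2 ^+ 2 - a1 ^+ 2 + D * (a1 ^+ 2 + 2 * a0 * a2)) * t w ^+ 2
  + (- 4 * a1 * a2 + 2 * D * a1 * a2) * t w ^+ 3
  + (D * a2 ^+ 2 - 4 * a2 ^+ 2) * t w ^+ 4)).
- by rewrite sint_quartic// /quad_energy; ring.
- have sz := @sboundedX _ _ _ 2 (@sbounded_zonal R d (quad a0 a1 a2)).
  have [] // := sboundedD (sbounded_enorm_sgrad (quad b a1 a2))
    (sboundedM (@sbounded_cst R d D) sz).
- by have [] := @sbounded_quartic R d ord_max (a1 ^+ 2 + D * a0 ^+ 2)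
    (4 * a1 * a2 + 2 * D * a0 * a1)
    (4 * a2 ^+ 2 - a1 ^+ 2 + D * (a1 ^+ 2 + 2 * a0 * a2))
    (- 4 * a1 * a2 + 2 * D * a1 * a2) (D * a2 ^+ 2 - 4 * a2 ^+ 2).
- by move=> w sw; rewrite enorm_sgrad_zonal// zonal_quad zonal_quad_deriv; ring.
Qed.

Lemma mean_quad a0 a1 a2 : mean (zon (quad a0 a1 a2)) = a0 + a2 * m2.
Proof.
have A0 := @sphere_area_gt0 R d.
rewrite /mean (eq_Rintegral sigma (g := fun w => a0 + a1 * t w + a2 * t w ^+ 2
   + 0 * t w ^+ 3 + 0 * t w ^+ 4)); last first.
  by move=> w _; rewrite zonal_quad !mul0r !addr0.
by rewrite sint_quartic// mulKf ?gt_eqF// mul0r addr0.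
Qed.

Lemma dist_mean_quad a0 a1 a2 :
  dist_mean q (zon (quad a0 a1 a2)) (sgrad (zon (quad a0 a1 a2))) ^+ 2 =
  A * quad_energy (- (a2 * m2)) a1 a2.
Proof.
rewrite -(H1norm_quad _ _ _ a0) /dist_mean; congr (H1norm q _ _ ^+ 2).
by apply/funext => w; rewrite mean_quad !zonal_quad; ring.
Qed.

Notation b := (d%:R * (q - 1) / (2 * (d%:R + 2))).

(** The polynomial whose zonal function is c times [u_eps q eps]. *)
Definition scaled_test c eps : {poly R} :=
  quad (c * (1 - eps ^+ 2 * b * m2)) (c * eps) (c * (eps ^+ 2 * b)).

Lemma zonal_scaled_test c eps w :
  zon (scaled_test c eps) w = c * u_eps q eps w.
Proof. by rewrite zonal_quad /u_eps div1r; ring. Qed.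

Lemma u_eps_zonal eps : u_eps q eps = zon (scaled_test 1 eps) :> ('rV[R]_n -> R).
Proof. by apply/funext => w; rewrite zonal_scaled_test mul1r. Qed.

(** Divided by the area, the squared distance of the test function to its mean
    is [fluct2] eps^2 + [fluct4] eps^4. *)
Definition fluct2 : R := (1 - m2) + D * m2.
Definition fluct4 : R := b ^+ 2 * (4 * (m2 - m4) + D * (m4 - m2 ^+ 2)).

Definition fluct eps : R := eps ^+ 2 * fluct2 + eps ^+ 4 * fluct4.

Lemma H1norm_scaled_test c eps :
  H1norm q (zon (scaled_test c eps)) (sgrad (zon (scaled_test c eps))) ^+ 2 =
  A * (c ^+ 2 * (D + fluct eps)).
Proof.
by rewrite H1norm_quad; congr (_ * _); rewrite /quad_energy /fluct /fluct2 /fluct4; ring.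
Qed.

Lemma dist_mean_scaled_test c eps :
  dist_mean q (zon (scaled_test c eps)) (sgrad (zon (scaled_test c eps))) ^+ 2 =
  A * (c ^+ 2 * fluct eps).
Proof.
by rewrite dist_mean_quad; congr (_ * _); rewrite /quad_energy /fluct /fluct2 /fluct4; ring.
Qed.

(** The relative excess of the integral of |u_eps|^q over that of 1. *)
Definition excess eps : R :=
  A^-1 * \int[sigma]_w (`|zon (scaled_test 1 eps) w| `^ q) - 1.

Lemma qnorm_scaled_test c eps : 0 <= c -> 0 <= 1 + excess eps ->
  qnorm q (zon (scaled_test c eps)) ^+ 2 =
  c ^+ 2 * A `^ (2 / q) * (1 + excess eps) `^ (2 / q).
Proof.
move=> c0 X0; have A0 := @sphere_area_gt0 R d.
have q0 : 0 < q by apply: lt_trans q2.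
have Z1 := @sbounded_powR R d _ q (ltW q0) (@sbounded_zonal R d (scaled_test 1 eps)).
rewrite /qnorm Lnorm_sbounded//; last exact: sbounded_zonal.
rewrite /fine (eq_Rintegral sigma (g := fun w => c `^ q * `|zon (scaled_test 1 eps) w| `^ q)); last first.
  move=> w _; rewrite !zonal_scaled_test mul1r normrM powRM// ger0_norm//.
rewrite sintZ//.
have -> : \int[sigma]_w (`|zon (scaled_test 1 eps) w| `^ q) = A * (1 + excess eps).
  by rewrite /excess addrCA subrr addr0 mulrA divff ?mul1r// gt_eqF.
rewrite powRM ?powR_ge0// ?mulr_ge0// ?(ltW A0)// powRM ?(ltW A0)//.
have sq x : (x `^ q^-1) ^+ 2 = x `^ (2 / q).
  by rewrite -powR_mulrn ?powR_ge0// -powRrM mulrC.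
by rewrite -powRrM divff ?gt_eqF// powRr1// !exprMn !sq mulrA.
Qed.

(** The power of the area in [Yconst] is the one that makes the deficit
    proportional to the area. *)
Lemma deficit_scaled_test c eps : 0 <= c -> 0 <= 1 + excess eps ->
  deficit q (zon (scaled_test c eps)) (sgrad (zon (scaled_test c eps))) =
  A * (c ^+ 2 * (D + fluct eps
    - D * (1 + excess eps) `^ (2 / q))).
Proof.
move=> c0 X0; have A0 := @sphere_area_gt0 R d.
rewrite /deficit H1norm_scaled_test qnorm_scaled_test// /Yconst.
have AE : A `^ (1 - 2 / q) * A `^ (2 / q) = A.
  by rewrite -powRD ?subrK ?powRr1 ?(ltW A0)// (gt_eqF A0) implybT.
have -> : D * A `^ (1 - 2 / q) * (c ^+ 2 * A `^ (2 / q) * (1 + excess eps) `^ (2 / q))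
  = (A `^ (1 - 2 / q) * A `^ (2 / q)) * (D * c ^+ 2 * (1 + excess eps) `^ (2 / q)) by ring.
by rewrite AE; ring.
Qed.

Lemma excess_ge0 eps : 0 <= 1 + excess eps.
Proof.
rewrite /excess addrCA subrr addr0 mulr_ge0 ?invr_ge0 ?(ltW (@sphere_area_gt0 R d))//.
by apply: Rintegral_ge0 => w _; exact: powR_ge0.
Qed.

Lemma D_gt0 : 0 < D.
Proof. by rewrite divr_gt0 ?ltr0n// subr_gt0. Qed.

Lemma m2_gt0 : 0 < m2. Proof. by rewrite invr_gt0 natr1 ltr0n. Qed.

Lemma fluct2_gt0 : 0 < fluct2.
Proof.
apply: ltr_wpDl; last by apply: mulr_gt0; [exact: D_gt0|exact: m2_gt0].
by rewrite subr_ge0 invf_le1 natr1 ?ltr0n// ler1n.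
Qed.

Lemma moments_le : m2 ^+ 2 <= m4 <= m2.
Proof.
have x1 : 1 <= d%:R :> R by rewrite ler1n.
set x : R := d%:R in x1 *.
have x1' : x + 1 != 0 by rewrite gt_eqF//; lra.
have x3' : x + 3 != 0 by rewrite gt_eqF//; lra.
apply/andP; split; rewrite -subr_ge0.
  have -> : 3 / ((x + 1) * (x + 3)) - (x + 1)^-1 ^+ 2 = 2 * x / ((x + 1) ^+ 2 * (x + 3)).
    by field; rewrite x1' x3'.
  by rewrite divr_ge0 ?mulr_ge0 ?sqr_ge0//; lra.
have -> : (x + 1)^-1 - 3 / ((x + 1) * (x + 3)) = x / ((x + 1) * (x + 3)).
  by field; rewrite x1' x3'.
by rewrite divr_ge0 ?mulr_ge0//; lra.
Qed.

Lemma fluct4_ge0 : 0 <= fluct4.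
Proof.
have /andP[h1 h2] := moments_le.
rewrite /fluct4 mulr_ge0 ?sqr_ge0// addr_ge0// mulr_ge0 ?subr_ge0//.
exact: ltW D_gt0.
Qed.

Lemma fluct_gt0 eps : 0 < eps -> 0 < fluct eps.
Proof.
move=> e0; rewrite /fluct; apply: ltr_pwDl.
  by apply: mulr_gt0; [exact: exprn_gt0|exact: fluct2_gt0].
by apply: mulr_ge0; [exact/exprn_ge0/ltW|exact: fluct4_ge0].
Qed.

(** The variance about any constant is positive. *)
Lemma nonconstant_scaled_test c eps : 0 < c -> 0 < eps ->
  nonconstant (zon (scaled_test c eps) : 'rV[R]_n -> R).
Proof.
move=> c0 e0 [k uk].
pose f w := (zon (scaled_test c eps) w - k) ^+ 2.
have sf : @sbounded R d f.
  by apply/sboundedX/sboundedB; [exact: sbounded_zonal|exact: sbounded_cst].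
have : \int[sigma]_w f w = 0.
  rewrite /Rintegral (ae_eq_integral (fun=> 0%E)) ?integral0//.
  - by apply/measurable_EFinP; case: sf.
  - by move: uk; apply: filterS => w uw _; rewrite /f uw subrr expr0n.
suff : 0 < \int[sigma]_w f w by move=> /[swap] ->; rewrite ltxx.
set a0 := c * (1 - eps ^+ 2 * b * m2).
set a2 := c * (eps ^+ 2 * b); set a1 := c * eps.
have -> : \int[sigma]_w f w = A * ((a0 - k + a2 * m2) ^+ 2 + a1 ^+ 2 * m2 + a2 ^+ 2 * (m4 - m2 ^+ 2)).
  rewrite (eq_Rintegral sigma (g := fun w => (a0 - k) ^+ 2
    + 2 * (a0 - k) * a1 * t w + (a1 ^+ 2 + 2 * (a0 - k) * a2) * t w ^+ 2
    + 2 * a1 * a2 * t w ^+ 3 + a2 ^+ 2 * t w ^+ 4)).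
    by rewrite sint_quartic//; ring.
  by move=> w _; rewrite /f zonal_quad -/a0 -/a1 -/a2; ring.
have /andP[h1 _] := moments_le.
apply: mulr_gt0; first exact: sphere_area_gt0.
apply: ltr_pwDl; last first.
  by rewrite mulr_ge0 ?sqr_ge0// subr_ge0.
apply: ltr_wpDl; first exact: sqr_ge0.
by apply: mulr_gt0; [rewrite exprn_gt0// mulr_gt0|exact: m2_gt0].
Qed.

End quadratic.

(** * Expansion of the q-norm *)

Section expansion.
Context {R : realType} {d : nat} (q : R).
Context (d0 : (0 < d)%N) (q2 : 2 < q).
Notation sigma := (@sphere_measure R d).
Notation n := d.+1.
Notation t w := (w 0 ord_max).
Notation A := (@sphere_area R d).
Notation zon := (@zonal R d).
Notation m2 := ((d%:R + 1)^-1 : R).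
Notation m4 := (3 / ((d%:R + 1) * (d%:R + 3)) : R).
Notation D := (d%:R / (q - 2)).
Notation b := (d%:R * (q - 1) / (2 * (d%:R + 2))).
Implicit Types (w : 'rV[R]_n) (a c eps : R).

Lemma binpoly5E (p s : R) : (binpoly 5 p).[s] =
  1 + p * s + gbin p 2 * s ^+ 2 + gbin p 3 * s ^+ 3 + gbin p 4 * s ^+ 4.
Proof.
rewrite /binpoly horner_poly !big_ord_recr big_ord0 /= add0r.
by rewrite gbin0 gbin1 expr0 expr1 mulr1.
Qed.

(** The coefficients of eps^2 and eps^4 in [excess]. *)
Definition excess2 : R := gbin q 2 * m2.
Definition excess4 : R := gbin q 2 * b ^+ 2 * m2 ^+ 2
  - m2 * (2 * gbin q 2 * b ^+ 2 * m2 + 3 * gbin q 3 * b * m2)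
  + m4 * (gbin q 2 * b ^+ 2 + 3 * gbin q 3 * b + gbin q 4).

Let norm_monomial (x y z : R) i j k : `|x| <= 1 -> `|y| <= 1 -> `|z| <= 1 ->
  `|x ^+ i * y ^+ j * z ^+ k| <= 1.
Proof.
move=> hx hy hz; rewrite !normrM !normrX.
by rewrite mulr_ile1 ?mulr_ge0 ?exprn_ge0 ?mulr_ile1 ?exprn_ile1.
Qed.

(** The fourth order polynomial in s = eps x + eps^2 B (x^2 - m), truncated at
    order four in eps; the truncation is of degree four in x. *)
Lemma quartic_truncation (g2 g3 g4 B m : R) : exists K, forall eps x s : R,
  0 < eps <= 1 -> `|x| <= 1 -> `|x ^+ 2 - m| <= 1 ->
  s = eps * x + eps ^+ 2 * B * (x ^+ 2 - m) ->
  `|(1 + q * s + g2 * s ^+ 2 + g3 * s ^+ 3 + g4 * s ^+ 4)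
  - ((1 - q * (eps ^+ 2 * B * m) + g2 * eps ^+ 4 * B ^+ 2 * m ^+ 2)
     + (q * eps - 2 * g2 * eps ^+ 3 * B * m) * x
     + (q * eps ^+ 2 * B + g2 * (eps ^+ 2 - 2 * eps ^+ 4 * B ^+ 2 * m)
        - 3 * g3 * eps ^+ 4 * B * m) * x ^+ 2
     + (2 * g2 * eps ^+ 3 * B + g3 * eps ^+ 3) * x ^+ 3
     + (g2 * eps ^+ 4 * B ^+ 2 + 3 * g3 * eps ^+ 4 * B + g4 * eps ^+ 4) * x ^+ 4)|
  <= K * eps ^+ 5.
Proof.
exists (`|g3 * 3 * B ^+ 2| + `|g3 * B ^+ 3| + `|g4 * 4 * B|
  + `|g4 * 6 * B ^+ 2| + `|g4 * 4 * B ^+ 3| + `|g4 * B ^+ 4|).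
move=> eps x s /andP[e0 e1] x1 P1 sE.
set P := x ^+ 2 - m in P1 sE *.
have ne : `|eps| <= 1 by rewrite ger0_norm// ltW.
set L := (X in `|X| <= _).
have -> : L = (g3 * 3 * B ^+ 2 * (eps ^+ 0 * x ^+ 1 * P ^+ 2)
  + g3 * B ^+ 3 * (eps ^+ 1 * x ^+ 0 * P ^+ 3)
  + g4 * 4 * B * (eps ^+ 0 * x ^+ 3 * P ^+ 1)
  + g4 * 6 * B ^+ 2 * (eps ^+ 1 * x ^+ 2 * P ^+ 2)
  + g4 * 4 * B ^+ 3 * (eps ^+ 2 * x ^+ 1 * P ^+ 3)
  + g4 * B ^+ 4 * (eps ^+ 3 * x ^+ 0 * P ^+ 4)) * eps ^+ 5.
  by rewrite /L sE /P; ring.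
rewrite normrM [X in _ * X]ger0_norm ?exprn_ge0 ?(ltW e0)// ler_wpM2r ?exprn_ge0 ?(ltW e0)//.
have mono c i j k : `|c * (eps ^+ i * x ^+ j * P ^+ k)| <= `|c|.
  by rewrite normrM ler_piMr// norm_monomial.
do 5 (apply: le_trans (ler_normD _ _) _; apply: lerD; last exact: mono).
exact: mono.
Qed.

(** Integration of the truncated binomial expansion; its terms of order one and
    three in eps are odd in the last coordinate and drop out. *)
Lemma excess_expansion : exists K e0 : R, [/\ 0 <= K, 0 < e0 <= 1 &
  forall eps, 0 < eps <= e0 ->
  `|@excess R d q eps - (excess2 * eps ^+ 2 + excess4 * eps ^+ 4)| <= K * eps ^+ 5].
Proof.
have A0 := @sphere_area_gt0 R d.
have q0 : 0 < q by apply: lt_trans q2.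
have b0 : 0 <= b.
  have q1 : 0 <= q - 1 by rewrite subr_ge0; apply: le_trans (ltW q2); rewrite ler1n.
  by apply: divr_ge0; apply: mulr_ge0 => //; rewrite addr_ge0.
have [K1 [K10 HK1]] := @powR_taylor R 5 q.
have [K2 HK2] := quartic_truncation (gbin q 2) (gbin q 3) (gbin q 4) b m2.
have m20 := @m2_gt0 R d.
have m21 : m2 <= 1 by rewrite invf_le1 natr1 ?ltr0n// ler1n.
exists (K1 * (1 + b) ^+ 5 + `|K2|), (2 * (1 + b))^-1.
have h0 : 0 < (2 * (1 + b))^-1 by rewrite invr_gt0 mulr_gt0// ltr_pwDl.
have h1 : (2 * (1 + b))^-1 <= 1.
  rewrite invf_le1 ?mulr_gt0 ?ltr_pwDl//.
  by move: b0; set B := b; lra.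
split; [|by rewrite h0|].
  by rewrite addr_ge0// mulr_ge0// exprn_ge0// addr_ge0.
move=> eps /andP[e0 eh].
have e1 : eps <= 1 := le_trans eh h1.
set c0 := 1 - q * (eps ^+ 2 * b * m2) + gbin q 2 * eps ^+ 4 * b ^+ 2 * m2 ^+ 2.
set c1 := q * eps - 2 * gbin q 2 * eps ^+ 3 * b * m2.
set c2 := q * eps ^+ 2 * b + gbin q 2 * (eps ^+ 2 - 2 * eps ^+ 4 * b ^+ 2 * m2)
        - 3 * gbin q 3 * eps ^+ 4 * b * m2.
set c3 := 2 * gbin q 2 * eps ^+ 3 * b + gbin q 3 * eps ^+ 3.
set c4 := gbin q 2 * eps ^+ 4 * b ^+ 2 + 3 * gbin q 3 * eps ^+ 4 * b + gbin q 4 * eps ^+ 4.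
have IT := @sint_quartic R d d0 ord_max c0 c1 c2 c3 c4.
have sT := @sbounded_quartic R d ord_max c0 c1 c2 c3 c4.
set T := (fun w => _) in IT sT.
set u := zon (@scaled_test R d q 1 eps).
have su : @sbounded R d (fun w => `|u w| `^ q).
  by apply: sbounded_powR; [exact: ltW|exact: sbounded_zonal].
have -> : @excess R d q eps - (excess2 * eps ^+ 2 + excess4 * eps ^+ 4) =
    A^-1 * \int[sigma]_w (`|u w| `^ q - T w).
  rewrite sintB// IT mulrBr mulKf ?gt_eqF// /excess -/u -addrA -opprD.
  by congr (_ - _); rewrite /excess2 /excess4 /c0 /c2 /c4; ring.
rewrite normrM ger0_norm ?invr_ge0 ?(ltW A0)// mulrC ler_pdivrMr//.
apply: sint_norm_le; first exact: sboundedB.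
move=> w sw; have t1 := sphere_coord ord_max sw.
have P1 : `|t w ^+ 2 - m2| <= 1.
  have : t w ^+ 2 <= 1 by rewrite -real_normK ?num_real// exprn_ile1.
  have := sqr_ge0 (t w); rewrite ler_norml; set x := t w ^+ 2.
  by move: m20 m21; set m := m2; lra.
have e01 : 0 < eps <= 1 by rewrite e0.
pose s := eps * t w + eps ^+ 2 * b * (t w ^+ 2 - m2).
have Hs := HK2 eps (t w) s e01 t1 P1 erefl.
have us : u w = 1 + s by rewrite /u zonal_scaled_test /u_eps /s div1r; ring.
have sb : `|s| <= eps * (1 + b).
  rewrite /s; have -> : eps * t w + eps ^+ 2 * b * (t w ^+ 2 - m2) =
    eps * (t w + eps * b * (t w ^+ 2 - m2)) by ring.
  rewrite normrM ger0_norm ?(ltW e0)// ler_wpM2l ?(ltW e0)//.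
  apply: le_trans (ler_normD _ _) _; apply: lerD => //.
  have eb0 := mulr_ge0 (ltW e0) b0.
  rewrite normrM (ger0_norm eb0); apply: (le_trans (ler_piMr eb0 P1)).
  exact: ler_piMl.
have s2 : `|s| <= 2^-1.
  apply: le_trans sb _; apply: le_trans (_ : (2 * (1 + b))^-1 * (1 + b) <= _).
    by rewrite ler_wpM2r ?addr_ge0.
  have : 1 + b != 0 by rewrite gt_eqF// ltr_pwDl.
  set B := 1 + b => B0; rewrite (_ : (2 * B)^-1 * B = 2^-1)//.
  by field.
have s0 : 0 <= 1 + s by move: s2; rewrite ler_norml; lra.
rewrite us (ger0_norm s0).
have := HK1 s s2; rewrite binpoly5E => H1.
set Q := 1 + q * s + _ + _ + _ in H1 Hs.
apply: (@le_trans _ _ `|((1 + s) `^ q - Q) + (Q - T w)|).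
  by rewrite [X in _ <= `|X|]addrA subrK.
apply: le_trans (ler_normD _ _) _; rewrite mulrDl; apply: lerD.
  rewrite (_ : K1 * (1 + b) ^+ 5 * eps ^+ 5 = K1 * (eps * (1 + b)) ^+ 5).
    apply: le_trans H1 _; apply: ler_wpM2l => //.
    by rewrite lerXn2r ?nnegrE// (le_trans _ sb).
  by set B := 1 + b; ring.
by apply: le_trans Hs _; rewrite ler_wpM2r ?exprn_ge0 ?(ltW e0)// ler_norm.
Qed.

End expansion.

(** * Expansion of the deficit *)

Section binomial_rate.
Context {R : realType}.

Lemma cvg_at_right_bound (f : R -> R) (l K : R) :
  (\forall x \near 0^'+, `|f x - l| <= K * x) -> f x @[x --> 0^'+] --> l.
Proof.
move=> fl; apply/cvgrPdist_le => e e0; near=> x.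
have x0 : 0 < x by near: x; exact: nbhs_right_gt.
have K0 : 0 < `|K| + 1 by rewrite ltr_wpDl.
have xe : x <= e / (`|K| + 1).
  by near: x; apply: nbhs_right_le; rewrite divr_gt0.
rewrite distrC; apply: (@le_trans _ _ (K * x)); first by near: x.
apply: (@le_trans _ _ ((`|K| + 1) * x)).
  by rewrite ler_wpM2r ?(ltW x0)// (le_trans (ler_norm K))// lerDl.
by rewrite mulrC -ler_pdivlMr.
Unshelve. all: by end_near. Qed.

(** If X = a2 e^2 + a4 e^4 + O(e^5), then (1 + X)^p is known to order e^4 from
    the second order binomial expansion; the coefficient of e^2 in the first
    summand is the one that cancels against that of D (1 + X)^p. *)
Lemma cvg_binomial_rate (X : R -> R) (p D a2 a4 b4 K e0 : R) :
  0 <= D -> 0 <= K -> 0 < e0 <= 1 ->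
  (forall e, 0 < e <= e0 ->
    `|X e - (a2 * e ^+ 2 + a4 * e ^+ 4)| <= K * e ^+ 5) ->
  (D + (e ^+ 2 * (D * (p * a2)) + e ^+ 4 * b4) - D * (1 + X e) `^ p) / e ^+ 4
    @[e --> 0^'+] --> b4 - D * (p * a4 + gbin p 2 * a2 ^+ 2).
Proof.
move=> D0 K0 /andP[e00 e01] HK.
have [K3 [K30 HK3]] := @powR_taylor R 3 p.
have [g gE] : exists g, g = gbin p 2 by exists (gbin p 2).
have [C CE] : exists C, C = `|a2| + `|a4| + K by exists (`|a2| + `|a4| + K).
have C0 : 0 <= C by rewrite CE !addr_ge0.
rewrite -gE.
apply: (@cvg_at_right_bound _ _
  (D * (`|p| * K + `|g| * (C * (2 * C)) + K3 * C ^+ 3))).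
near=> e.
have e_gt0 : 0 < e by near: e; exact: nbhs_right_gt.
have e_le : e <= e0 by near: e; exact: nbhs_right_le.
have eC : e <= (2 * (C + 1))^-1.
  by near: e; apply: nbhs_right_le; rewrite invr_gt0 mulr_gt0// ltr_wpDl.
have e1 : e <= 1 by exact: le_trans e_le e01.
have e_ge0 := ltW e_gt0.
have := HK e; rewrite e_gt0 e_le => /(_ isT) Hr.
set x := X e in Hr *; pose r := x - (a2 * e ^+ 2 + a4 * e ^+ 4).
rewrite -/r in Hr.
have e54 : e ^+ 5 <= e ^+ 4 by rewrite exprS ler_piMl// exprn_ge0.
have e42 : e ^+ 4 <= e ^+ 2.
  by rewrite (exprD e 2 2) ler_piMr ?exprn_ge0// exprn_ile1.
have xa2 : `|x - a2 * e ^+ 2| <= C * e ^+ 4.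
  have -> : x - a2 * e ^+ 2 = a4 * e ^+ 4 + r by rewrite /r; ring.
  apply: le_trans (ler_normD _ _) _; rewrite normrM (ger0_norm (exprn_ge0 4 e_ge0)).
  apply: (@le_trans _ _ (`|a4| * e ^+ 4 + K * e ^+ 4)).
    by rewrite lerD2l (le_trans Hr)// ler_wpM2l.
  by rewrite -mulrDl ler_wpM2r ?exprn_ge0// CE -addrA lerDr.
have xX : `|x| <= C * e ^+ 2.
  have -> : x = a2 * e ^+ 2 + (a4 * e ^+ 4 + r) by rewrite /r; ring.
  apply: le_trans (ler_normD _ _) _; rewrite CE -addrA mulrDl; apply: lerD.
    by rewrite normrM (ger0_norm (exprn_ge0 2 e_ge0)).
  apply: le_trans (ler_normD _ _) _; rewrite mulrDl; apply: lerD.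
    by rewrite normrM (ger0_norm (exprn_ge0 4 e_ge0)) ler_wpM2l.
  by rewrite (le_trans Hr)// ler_wpM2l// (le_trans e54).
have x2 : `|x| <= 2^-1.
  apply: le_trans xX _; apply: (@le_trans _ _ ((C + 1) * e)).
    apply: ler_pM; rewrite ?exprn_ge0 ?lerDl// expr2 ler_piMl//.
  rewrite mulrC -ler_pdivlMr ?ltr_wpDl//.
  by rewrite -invfM.
have := HK3 x x2; set y := (1 + x) `^ p.
have -> : (binpoly 3 p).[x] = 1 + p * x + g * x ^+ 2.
  rewrite gE /binpoly horner_poly !big_ord_recr big_ord0 /= add0r.
  by rewrite gbin0 gbin1 expr0 expr1 mulr1.
set rr := y - _ => Hrr.
have e4 : 0 < e ^+ 4 by rewrite exprn_gt0.
have -> : (D + (e ^+ 2 * (D * (p * a2)) + e ^+ 4 * b4) - D * (1 + x) `^ p) / e ^+ 4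
    - (b4 - D * (p * a4 + g * a2 ^+ 2)) =
  - (D * (p * r + g * ((x - a2 * e ^+ 2) * (x + a2 * e ^+ 2)) + rr)) / e ^+ 4.
  rewrite -/x -/y.
  have -> : y = rr + (1 + p * x + g * x ^+ 2) by rewrite /rr subrK.
  have -> : r = x - (a2 * e ^+ 2 + a4 * e ^+ 4) by [].
  by field; rewrite gt_eqF.
rewrite normrM normrN normrM (ger0_norm (D0)) [X in _ * X]ger0_norm; last first.
  by rewrite invr_ge0 ltW.
rewrite ler_pdivrMr// -!mulrA ler_wpM2l ?(D0)// -exprS.
have e65 : e ^+ 6 <= e ^+ 5 by rewrite exprS ler_piMl// exprn_ge0.
have B1 : `|p * r| <= `|p| * K * e ^+ 5 by rewrite normrM -mulrA ler_wpM2l.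
have B2 : `|g * ((x - a2 * e ^+ 2) * (x + a2 * e ^+ 2))|
    <= `|g| * (C * (2 * C)) * e ^+ 5.
  rewrite normrM -[leRHS]mulrA ler_wpM2l// normrM.
  apply: (@le_trans _ _ ((C * e ^+ 4) * (2 * C * e ^+ 2))).
    apply: ler_pM => //; apply: le_trans (ler_normD _ _) _.
    rewrite -mulrA mulr_natl mulr2n; apply: lerD => //.
    rewrite normrM (ger0_norm (exprn_ge0 2 e_ge0)) ler_wpM2r ?exprn_ge0//.
    by rewrite CE -addrA lerDl addr_ge0.
  have -> : C * e ^+ 4 * (2 * C * e ^+ 2) = (C * (2 * C)) * e ^+ 6 by ring.
  by rewrite ler_wpM2l ?mulr_ge0.
have B3 : `|rr| <= K3 * C ^+ 3 * e ^+ 5.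
  apply: (le_trans Hrr); rewrite -mulrA ler_wpM2l//.
  apply: (@le_trans _ _ ((C * e ^+ 2) ^+ 3)).
    by rewrite lerXn2r ?nnegrE ?mulr_ge0 ?exprn_ge0.
  by rewrite exprMn -exprM ler_wpM2l// exprn_ge0.
rewrite [leRHS]mulrDl [X in _ <= X + _]mulrDl.
apply: le_trans (ler_normD _ _) _; apply: lerD => //.
by apply: le_trans (ler_normD _ _) _; apply: lerD.
Unshelve. all: by end_near. Qed.

End binomial_rate.

Section rate.
Context {R : realType} {d : nat} (q : R).
Context (d0 : (0 < d)%N) (q2 : 2 < q).
Notation A := (@sphere_area R d).
Notation zon := (@zonal R d).
Notation D := (d%:R / (q - 2)).
Notation X := (@excess R d q).
Notation X2 := (@excess2 R d q).
Notation X4 := (@excess4 R d q).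
Notation E2 := (@fluct2 R d q).
Notation E4 := (@fluct4 R d q).
Notation p := (2 / q).
Notation test c eps := (zon (@scaled_test R d q c eps)).
Implicit Types c eps : R.

Lemma gbin2 (x : R) : gbin x 2 = x * (x - 1) / 2.
Proof. by rewrite /gbin !big_ord_recr big_ord0 /= subr0 mul1r. Qed.

Lemma gbin3 (x : R) : gbin x 3 = x * (x - 1) * (x - 2) / 6.
Proof. by rewrite /gbin !big_ord_recr big_ord0 /= subr0 mul1r. Qed.

Lemma gbin4 (x : R) : gbin x 4 = x * (x - 1) * (x - 2) * (x - 3) / 24.
Proof. by rewrite /gbin !big_ord_recr big_ord0 /= subr0 mul1r. Qed.

(** The limit of [rate] below. *)
Definition rate_limit : R := E4 - D * (p * X4 + gbin p 2 * X2 ^+ 2).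

Let xd : R := d%:R.
Let xd0 : 0 < xd. Proof. by rewrite ltr0n. Qed.
Let nz : [&& q != 0, q - 1 != 0, q - 2 != 0, xd != 0, xd + 1 != 0, xd + 2 != 0
  & xd + 3 != 0].
Proof.
have h := q2; have h' := xd0.
by apply/and5P; split; [| | | |apply/and3P; split]; rewrite gt_eqF//; lra.
Qed.

(** The terms of order eps^2 of the deficit cancel: the second variation of
    the deficit at the constants vanishes on the coordinate functions. *)
Lemma fluct2_excess2 : E2 = D * (p * X2).
Proof.
rewrite /fluct2 /excess2 gbin2 -/xd.
by case/and5P: nz => ? ? ? ? /and3P[? ? ?]; field; do ?[apply/andP; split].
Qed.

Lemma rate_limitE : D * rate_limit / E2 ^+ 2 = stability_const d q.
Proof.
rewrite /rate_limit /stability_const /fluct4 /excess4 /excess2 /fluct2.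
rewrite !gbin2 gbin3 gbin4 -/xd.
have -> : 1 - (xd + 1)^-1 + xd / (q - 2) * (xd + 1)^-1 =
   xd * (q - 1) / ((xd + 1) * (q - 2)).
  by case/and5P: nz => ? ? ? ? /and3P[? ? ?]; field; do ?[apply/andP; split].
by case/and5P: nz => ? ? ? ? /and3P[? ? ?]; field; do ?[apply/andP; split].
Qed.

(** The deficit of the test function, divided by the area and by eps^4. *)
Definition rate eps : R :=
  (D + @fluct R d q eps - D * (1 + X eps) `^ p) / eps ^+ 4.

Lemma cvg_rate : rate eps @[eps --> 0^'+] --> rate_limit.
Proof.
have [K [e0 [K0 e01 HK]]] := @excess_expansion R d q d0 q2.
rewrite /rate /fluct fluct2_excess2; exact: cvg_binomial_rate (ltW (@D_gt0 R d q d0 q2)) K0 e01 HK.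
Qed.

End rate.

(** * The stability quotient *)

Lemma cvg_to_at_right0 (R : realType) (u : nat -> R) : (forall k, 0 < u k) ->
  u k @[k --> \oo] --> 0 -> u k @[k --> \oo] --> 0^'+.
Proof.
move=> u0 ul P P0.
have : \forall k \near \oo, 0 < u k -> P (u k) := ul _ P0.
by apply: filterS => k; apply.
Qed.

Lemma cvg_poly_at_right0 (R : realType) (P : {poly R}) (f : R -> R) :
  (forall e, f e = P.[e]) -> f e @[e --> 0^'+] --> f 0.
Proof.
move=> /funext ->.
by apply: cvg_at_right_filter; exact: continuous_horner.
Qed.

Section quotient.
Context {R : realType} {d : nat} (q : R).
Context (d0 : (0 < d)%N) (q2 : 2 < q).
Notation A := (@sphere_area R d).
Notation D := (d%:R / (q - 2)).
Notation X := (@excess R d q).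
Notation E2 := (@fluct2 R d q).
Notation E4 := (@fluct4 R d q).
Notation F := (@fluct R d q).
Notation rate := (@rate R d q).
Notation test c eps := (@zonal R d (@scaled_test R d q c eps)).
Implicit Types c eps : R.

Lemma cvg_fluct : F eps @[eps --> 0^'+] --> 0.
Proof.
rewrite -[X in _ --> X](_ : F 0 = 0); last first.
  by rewrite /fluct !expr0n !mul0r addr0.
apply: (@cvg_poly_at_right0 _ (E2 *: 'X^2 + E4 *: 'X^4) F) => e.
by rewrite hornerD !hornerZ !hornerXn /fluct; ring.
Qed.

Lemma cvg_fluct_ratio : E2 + eps ^+ 2 * E4 @[eps --> 0^'+] --> E2.
Proof.
pose f eps := E2 + eps ^+ 2 * E4.
rewrite -[X in _ --> X](_ : f 0 = E2); last by rewrite /f expr0n mul0r addr0.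
apply: (@cvg_poly_at_right0 _ (E2%:P + E4 *: 'X^2) f) => e.
by rewrite hornerD hornerC hornerZ hornerXn /f; ring.
Qed.

Lemma deficit_rate c eps : 0 <= c -> 0 < eps ->
  deficit q (test c eps) (sgrad (test c eps)) =
  A * (c ^+ 2 * (eps ^+ 4 * rate eps)).
Proof.
move=> c0 e0; rewrite deficit_scaled_test ?excess_ge0//.
by congr (_ * (_ * _)); apply/esym; rewrite mulrC divfK// gt_eqF// exprn_gt0.
Qed.

Lemma stability_quotientE c eps : 0 < c -> 0 < eps ->
  stability_quotient q (test c eps) (sgrad (test c eps)) =
  (D + F eps) * rate eps / (E2 + eps ^+ 2 * E4) ^+ 2.
Proof.
move=> c0 e0; rewrite /stability_quotient (deficit_rate (ltW c0) e0).
have -> : dist_mean q (test c eps) (sgrad (test c eps)) ^+ 4 =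
    (A * (c ^+ 2 * F eps)) ^+ 2.
  by rewrite -dist_mean_scaled_test// -exprM.
rewrite H1norm_scaled_test//.
have A0 := @sphere_area_gt0 R d.
have E20 := @fluct2_gt0 R d q d0 q2; have E40 := @fluct4_ge0 R d q d0 q2.
have en : E2 + eps ^+ 2 * E4 != 0.
  by rewrite gt_eqF// ltr_wpDr// mulr_ge0// exprn_ge0// ltW.
rewrite /fluct.
move: (rate eps) D E2 E4 A A0 en => r D' e2 e4 a a0 en.
have -> : eps ^+ 2 * e2 + eps ^+ 4 * e4 = eps ^+ 2 * (e2 + eps ^+ 2 * e4) by ring.
have cn : c != 0 by rewrite gt_eqF.
have epsn : eps != 0 by rewrite gt_eqF.
have an : a != 0 by rewrite gt_eqF.
by field; do ?[apply/andP; split].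
Qed.

Lemma cvg_stability_quotient :
  (D + F eps) * rate eps / (E2 + eps ^+ 2 * E4) ^+ 2
    @[eps --> 0^'+] --> stability_const d q.
Proof.
rewrite -(rate_limitE d0 q2); apply: cvgM; last first.
  apply: cvgV; first by rewrite sqrf_eq0 gt_eqF// (fluct2_gt0 d0 q2).
  under eq_fun do rewrite expr2; rewrite expr2.
  by apply: cvgM; exact: cvg_fluct_ratio.
apply: cvgM; last exact: cvg_rate.
by rewrite -[X in _ --> X]addr0; apply: cvgD; [exact: cvg_cst|exact: cvg_fluct].
Qed.

(** The factor that gives the test function the squared norm [Yconst]. *)
Definition normalizer eps : R :=
  Num.sqrt (@Yconst R d q / (A * (D + F eps))).

Let D0 : 0 < D. Proof. exact: D_gt0. Qed.
Let A0 : 0 < A. Proof. exact: sphere_area_gt0. Qed.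

Let Y0 : 0 < @Yconst R d q.
Proof. by rewrite mulr_gt0 ?powR_gt0. Qed.

Let Den eps : 0 < eps -> 0 < D + F eps.
Proof. by move=> e0; rewrite addr_gt0// (fluct_gt0 d0 q2). Qed.

Lemma normalizer_gt0 eps : 0 < eps -> 0 < normalizer eps.
Proof. by move=> e0; rewrite sqrtr_gt0 divr_gt0// mulr_gt0// Den. Qed.

Lemma H1norm_normalized eps : 0 < eps ->
  H1norm q (test (normalizer eps) eps) (sgrad (test (normalizer eps) eps)) ^+ 2
  = @Yconst R d q.
Proof.
move=> e0; have De := Den e0.
rewrite H1norm_scaled_test// sqr_sqrtr; last first.
  by rewrite divr_ge0 ?(ltW Y0)// mulr_ge0 ?ltW.
have Bn := lt0r_neq0 De; have An := lt0r_neq0 A0.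
by move: (D + F eps) A An Bn => B a an Bn; field; rewrite an Bn.
Qed.

(** Read off from the deficit, since the squared norm is [Yconst]. *)
Lemma qnorm_normalized eps : 0 < eps ->
  qnorm q (test (normalizer eps) eps) ^+ 2 =
  1 - eps ^+ 4 * rate eps / (D + F eps).
Proof.
move=> e0; have De := Den e0.
have := deficit_rate (ltW (normalizer_gt0 e0)) e0.
rewrite /deficit H1norm_normalized// sqr_sqrtr; last first.
  by rewrite divr_ge0 ?(ltW Y0)// mulr_ge0 ?ltW.
have nY : @Yconst R d q != 0 by rewrite gt_eqF.
set Q := qnorm _ _ => E; apply: (mulfI nY).
rewrite mulrBr mulr1 -[LHS](subKr (@Yconst R d q)) E; congr (_ - _).
have Bn := lt0r_neq0 De; have An := lt0r_neq0 A0.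
by move: (D + F eps) A An Bn => B a an Bn; field; rewrite an Bn.
Qed.

Lemma cvg_qnorm_normalized :
  qnorm q (test (normalizer eps) eps) @[eps --> 0^'+] --> (1 : R).
Proof.
have E : \forall eps \near 0^'+, Num.sqrt (1 - eps ^+ 4 * rate eps / (D + F eps)) =
    qnorm q (test (normalizer eps) eps).
  near=> eps; have e0 : 0 < eps by near: eps; exact: nbhs_right_gt.
  by rewrite -qnorm_normalized// sqrtr_sqr ger0_norm// fine_ge0// Lnorm_ge0.
suff F : Num.sqrt (1 - eps ^+ 4 * rate eps / (D + F eps)) @[eps --> 0^'+] --> (1 : R).
  exact: cvg_trans (near_eq_cvg E) F.
rewrite -[X in _ --> X]sqrtr1; apply: (@continuous_cvg _ _ _ _ _ _ (@Num.sqrt R)).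
  exact: sqrt_continuous.
rewrite -[X in _ --> X]subr0; apply: cvgB; first exact: cvg_cst.
rewrite -[X in _ --> X](mul0r (D + 0)^-1); apply: cvgM; last first.
  apply: cvgV; first by rewrite addr0 gt_eqF.
  by apply: cvgD; [exact: cvg_cst|exact: cvg_fluct].
rewrite -[X in _ --> X](mul0r (rate_limit (d := d) q)); apply: cvgM; last exact: cvg_rate.
rewrite -[X in _ --> X](_ : (0 : R) ^+ 4 = 0); last by rewrite expr0n.
apply: (@cvg_poly_at_right0 _ 'X^4 (fun e => e ^+ 4)) => e.
by rewrite hornerXn.
Unshelve. all: by end_near. Qed.

(** An inequality with the power alpha is one with the power 4, up to a factor
    (M / N)^(4 - alpha); below, N and M are the H^1 norms of u and of its
    deviation from the mean. *)
Lemma quotient_powR (N M f c alpha : R) : 0 < N -> 0 < M ->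
  c * N `^ (2 - alpha) * M `^ alpha <= f ->
  c <= N ^+ 2 * f / M ^+ 4 * (M ^+ 2 / N ^+ 2) `^ ((4 - alpha) / 2).
Proof.
move=> N0 M0 cf.
have E : (M ^+ 2 / N ^+ 2) `^ ((4 - alpha) / 2) = M `^ (4 - alpha) * N `^ (alpha - 4).
  rewrite -expr_div_n -powR_mulrn ?divr_ge0 ?ltW// -powRrM.
  rewrite (_ : 2 * ((4 - alpha) / 2) = 4 - alpha); last by field.
  rewrite powRM ?invr_ge0 ?ltW//; congr (_ * _).
  by rewrite -powR_inv1 ?ltW// -powRrM; congr (_ `^ _); ring.
have nN : N != 0 by rewrite gt_eqF.
have nM : M != 0 by rewrite gt_eqF.
have EN : N ^+ 2 * N `^ (alpha - 4) = N `^ (alpha - 2).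
  rewrite -powR_mulrn ?ltW// -powRD; last by rewrite nN implybT.
  by congr (_ `^ _); ring.
have EM : (M ^+ 4)^-1 * M `^ (4 - alpha) = M `^ (- alpha).
  rewrite -powR_mulrn ?ltW// -powRN -powRD; last by rewrite nM implybT.
  by congr (_ `^ _); ring.
have -> : N ^+ 2 * f / M ^+ 4 * (M ^+ 2 / N ^+ 2) `^ ((4 - alpha) / 2) =
    f * (N `^ (alpha - 2) * M `^ (- alpha)).
  by rewrite E -EN -EM; ring.
have -> : c = (c * N `^ (2 - alpha) * M `^ alpha) * (N `^ (alpha - 2) * M `^ (- alpha)).
  have EN1 : N `^ (2 - alpha) * N `^ (alpha - 2) = 1.
    by rewrite -powRD ?nN ?implybT// (_ : 2 - alpha + (alpha - 2) = 0) ?powRr0//; ring.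
  have EM1 : M `^ alpha * M `^ (- alpha) = 1.
    by rewrite -powRD ?nM ?implybT// subrr powRr0.
  transitivity (c * (N `^ (2 - alpha) * N `^ (alpha - 2)) * (M `^ alpha * M `^ (- alpha))).
    by rewrite EN1 EM1 !mulr1.
  by ring.
by rewrite ler_wpM2r// mulr_ge0 ?powR_ge0.
Qed.

End quotient.

Theorem mainTheorem6 (R : realType) (d : nat) (q : R)
    (hd : (2 <= d)%N) (hq2 : 2 < q)
    (hq : (2 < d)%N -> q < 2 * d%:R / (d%:R - 2)) :
  [/\ stability_quotient q (u_eps q eps) (sgrad (u_eps (d := d) q eps))
        @[eps --> 0^'+] --> stability_const d q,
      forall C : R, stability_const d q < C -> ~ liminf_bound d q C &
      forall alpha : R, alpha < 4 ->
        ~ exists2 c : R, 0 < c &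
            forall (u : 'rV[R]_d.+1 -> R) (G : 'rV[R]_d.+1 -> 'rV[R]_d.+1),
              H1 u G -> nonconstant u ->
              c * H1norm q u G `^ (2 - alpha) * dist_mean q u G `^ alpha
                <= deficit q u G].
Proof.
have d0 : (0 < d)%N by exact: ltnW.
have L := cvg_stability_quotient d0 hq2.
pose e k : R := harmonic k.
have e_gt0 k : 0 < e k by exact: harmonic_gt0.
have e_cvg : e k @[k --> \oo] --> 0^'+.
  by apply: cvg_to_at_right0 => //; exact: cvg_harmonic.
split.
- apply: cvg_trans L; apply: near_eq_cvg; near=> eps.
  have eps0 : 0 < eps by near: eps; exact: nbhs_right_gt.
  by rewrite u_eps_zonal stability_quotientE.
- move=> C ltC bC.
  pose u k := @zonal R d (@scaled_test R d q (normalizer (d := d) q (e k)) (e k)).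
  have c0 k : 0 < normalizer (d := d) q (e k) by exact: normalizer_gt0.
  have := bC u (fun k => sgrad (u k)).
  have -> : limn_einf (fun k => (stability_quotient q (u k) (sgrad (u k)))%:E) =
      (stability_const d q)%:E.
    apply: (cvg_limn_einf_sup _).1; apply: cvg_EFin; first by near=> k.
    have := cvg_comp _ _ e_cvg L; apply: cvg_trans; apply: near_eq_cvg.
    by near=> k; rewrite /= /u stability_quotientE.
  rewrite lee_fin leNgt ltC /= => H; apply: notF; apply: H.
  + move=> k; split; first exact: H1_zonal.
    exact: nonconstant_scaled_test.
  + by move=> k; exact: H1norm_normalized.
  + exact: cvg_comp _ _ e_cvg (cvg_qnorm_normalized d0 hq2).
(* c is at most f k * g k ^ ((4 - alpha) / 2), which tends to 0. *)
move=> alpha alpha4 [c c0 Hc].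
pose f k := (d%:R / (q - 2) + fluct (d := d) q (e k)) * rate (d := d) q (e k)
  / (fluct2 (d := d) q + e k ^+ 2 * fluct4 (d := d) q) ^+ 2.
pose g k := fluct (d := d) q (e k) / (d%:R / (q - 2) + fluct (d := d) q (e k)).
have D0 := @D_gt0 R d q d0 hq2.
have en0 k : 0 < fluct (d := d) q (e k) by exact: fluct_gt0.
have gg k : 0 < g k by rewrite divr_gt0// addr_gt0.
have g_cvg : g k @[k --> \oo] --> 0^'+.
  apply: cvg_to_at_right0 => //.
  have ec := cvg_comp _ _ e_cvg (@cvg_fluct R d q).
  rewrite -[X in _ --> X](mul0r (d%:R / (q - 2) + 0)^-1); apply: cvgM => //.
  apply: cvgV; first by rewrite addr0 gt_eqF.
  by apply: cvgD => //; exact: cvg_cst.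
have b0 : 0 < (4 - alpha) / 2 by rewrite divr_gt0// subr_gt0.
have fg : f k * g k `^ ((4 - alpha) / 2) @[k --> \oo] --> stability_const d q * 0.
  apply: cvgM; first exact: cvg_comp _ _ e_cvg L.
  exact: cvg_comp _ _ g_cvg (powR_cvg0 b0).
suff : c <= stability_const d q * 0 by rewrite mulr0 leNgt c0.
apply: (cvgr_to_ge fg); near=> k.
pose u := @zonal R d (@scaled_test R d q 1 (e k)).
have A0 := @sphere_area_gt0 R d.
have HN := @H1norm_scaled_test R d q d0 hq2 1 (e k).
have HM := @dist_mean_scaled_test R d q d0 hq2 1 (e k).
rewrite !expr1n !mul1r -/u in HN HM.
have N0 : 0 < H1norm q u (sgrad u).
  rewrite lt_def sqrtr_ge0 andbT -sqrf_eq0 HN gt_eqF// mulr_gt0// addr_gt0//.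
have M0 : 0 < dist_mean q u (sgrad u).
  by rewrite lt_def sqrtr_ge0 andbT -sqrf_eq0 HM gt_eqF// mulr_gt0.
have := Hc u (sgrad u) (H1_zonal _) (nonconstant_scaled_test d0 ltr01 (e_gt0 k)).
move/(quotient_powR N0 M0).
rewrite -/(stability_quotient q u (sgrad u)) stability_quotientE// -/(f k) HN HM.
by rewrite -mulf_div divff ?gt_eqF// mul1r.
Unshelve. all: by end_near. Qed.
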